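(* Let $\varphi\colon\mathbb{R}_+\to\mathbb{R}_+$ be a map satisfying $\varphi(t)=o\left(t^{1/3}\right)$ as $t\to+\infty$. The set of irrational numbers $\theta$ whose associated irrational rotation $R_\theta$ is $\varphi$-integrably orbit equivalent to the universal odometer is dense in $\mathbb{R}$.
   Context: For irrational $\theta$, $R_\theta\colon z\mapsto e^{2i\pi\theta}z$ is the irrational rotation on the unit circle with its Haar probability measure. All probability spaces are standard and atomless; $\mathrm{Aut}(X,\mu)$ is the set of bimeasurable bijections of $X$ preserving the probability measure $\mu$, two such maps being identified if they coincide almost everywhere. **Orbit equivalence.** Aperiodic $S\in\mathrm{Aut}(X,\mu)$ and $T\in\mathrm{Aut}(Y,\nu)$ are orbit equivalent if there is a bimeasurable bijection $\Psi\colon X\to Y$ with $\Psi_\star\mu=\nu$ such that $S$ and $\Psi^{-1}T\Psi$ have the same orbits at almost every point. The associated cocycles $c_S\colon X\to\mathbb{Z}$, $c_T\colon Y\to\mathbb{Z}$ are defined almost everywhere by $Sx=\Psi^{-1}T^{c_S(x)}\Psi(x)$ and $Ty=\Psi S^{c_T(y)}\Psi^{-1}(y)$. $S$ and $T$ are $\varphi$-integrably orbit equivalent if some orbit equivalence $\Psi$ satisfies $\int_X\varphi(|c_S|)\,d\mu<+\infty$ and $\int_Y\varphi(|c_T|)\,d\nu<+\infty$. **Universal odometer.** For integers $q_n\ge 2$, the odometer on $\prod_{n\ge0}\{0,\dots,q_n-1\}$ (with the product of the uniform probability measures) is the addition of $(1,0,0,\dots)$ with carry over to the right. It is universal if every prime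 number has infinite multiplicity as a prime factor among the $q_n$, $n\ge0$. The universal odometer is unique up to conjugacy. *)

(* Defs.v *)
From HB Require Import structures.
From mathcomp Require Import all_boot all_order all_algebra.
From mathcomp Require Import complex.
From mathcomp Require Import all_classical all_reals all_analysis.
From mathcomp Require Import measurable_realfun.
From mathcomp Require Import ring lra zify.

Set Implicit Arguments.
Unset Strict Implicit.
Unset Printing Implicit Defensive.

Import Order.TTheory GRing.Theory Num.Theory.
Import numFieldNormedType.Exports.

Local Open Scope classical_set_scope.
Local Open Scope ring_scope.

(* Lets the Landau notations be used at +oo. *)
Canonical pinfty_nbhs_filter_on (R : numFieldType) :=
  FilterType (pinfty_nbhs R) _.

(* Measure-preserving bijections are everywhere defined, with an everywhere
   defined inverse; equality almost everywhere is not quotiented out, since all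
   the notions below are insensitive to it. *)
Record mpiso d d' (X : measurableType d) (Y : measurableType d') (R : realType)
    (mu : probability X R) (nu : probability Y R) := MPIso {
  mpfun :> X -> Y ;
  mpinv : Y -> X ;
  mpfunK : cancel mpfun mpinv ;
  mpinvK : cancel mpinv mpfun ;
  measurable_mpfun : measurable_fun setT mpfun ;
  measurable_mpinv : measurable_fun setT mpinv ;
  mpfun_pushforward :
    forall A, measurable A -> pushforward mu mpfun A = nu A }.

Section MPIsoTheory.
Context (R : realType) d1 d2 d3 (X1 : measurableType d1)
  (X2 : measurableType d2) (X3 : measurableType d3).
Context (m1 : probability X1 R) (m2 : probability X2 R) (m3 : probability X3 R).

Lemma mpsym_pushforward (f : mpiso m1 m2) A :
  measurable A -> pushforward m2 (mpinv f) A = m1 A.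
Proof.
move=> mA; have mB : measurable (mpinv f @^-1` A).
  by rewrite -[X in measurable X]setTI; exact: measurable_mpinv.
rewrite /pushforward; apply: etrans (esym (mpfun_pushforward f mB)) _.
rewrite /pushforward; congr (m1 _).
by apply/seteqP; split => x /=; rewrite mpfunK.
Qed.

Definition mpsym (f : mpiso m1 m2) : mpiso m2 m1 :=
  MPIso (mpinvK f) (mpfunK f) (measurable_mpinv f) (measurable_mpfun f)
        (mpsym_pushforward f).

Lemma mpcomp_pushforward (g : mpiso m2 m3) (f : mpiso m1 m2) A :
  measurable A -> pushforward m1 (g \o f) A = m3 A.
Proof.
move=> mA; apply: etrans _ (mpfun_pushforward g mA).
apply: etrans _ (mpfun_pushforward f _) => //.
by rewrite -[X in measurable X]setTI; exact: measurable_mpfun.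
Qed.

Definition mpcomp (g : mpiso m2 m3) (f : mpiso m1 m2) : mpiso m1 m3 :=
  MPIso (can_comp (mpfunK g) (mpfunK f)) (can_comp (mpinvK f) (mpinvK g))
        (measurableT_comp (measurable_mpfun g) (measurable_mpfun f))
        (measurableT_comp (measurable_mpinv f) (measurable_mpinv g))
        (mpcomp_pushforward g f).

End MPIsoTheory.

Notation aut mu := (mpiso mu mu).

Section Automorphisms.
Context (R : realType) d (X : measurableType d) (mu : probability X R).
Implicit Type S : aut mu.

Definition aut_iter S (k : int) : X -> X :=
  match k with
  | Posz n => iter n S
  | Negz n => iter n.+1 (mpinv S)
  end.

Definition orbit_of S (x : X) : set X := range (fun k : int => aut_iter S k x).

Definition aperiodic S :=
  {ae mu, forall x, forall n, (0 < n)%N -> iter n S x <> x}.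

End Automorphisms.

Section OrbitEquivalence.
Context (R : realType) d d' (X : measurableType d) (Y : measurableType d').
Context (mu : probability X R) (nu : probability Y R).

(* Psi^-1 T Psi *)
Definition mpconj (Psi : mpiso mu nu) (T : aut nu) : aut mu :=
  mpcomp (mpsym Psi) (mpcomp T Psi).

Definition orbit_equivalence (S : aut mu) (T : aut nu) (Psi : mpiso mu nu) :=
  {ae mu, forall x, orbit_of S x = orbit_of (mpconj Psi T) x}.

(* When T is aperiodic, this determines c up to a negligible set. *)
Definition is_cocycle (S : aut mu) (T : aut nu) (Psi : mpiso mu nu)
    (c : X -> int) :=
  (forall k, measurable (c @^-1` [set k])) /\
  {ae mu, forall x, S x = mpinv Psi (aut_iter T (c x) (Psi x))}.

End OrbitEquivalence.

Definition integrably_orbit_equivalent (R : realType) (phi : R -> R) d d'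
    (X : measurableType d) (Y : measurableType d')
    (mu : probability X R) (nu : probability Y R) (S : aut mu) (T : aut nu) :=
  [/\ aperiodic S, aperiodic T &
  exists Psi : mpiso mu nu, orbit_equivalence S T Psi /\
  exists cS cT,
    [/\ is_cocycle S T Psi cS, is_cocycle T S (mpsym Psi) cT,
        (\int[mu]_x (phi `|cS x|%N%:R)%:E < +oo)%E &
        (\int[nu]_y (phi `|cT y|%N%:R)%:E < +oo)%E] ].

Section UnitInterval.
Context (R : realType).

Definition unif01 : probability (measurableTypeR R) R := uniform_prob (@ltr01 R).

Lemma unif01E (A : set (measurableTypeR R)) : measurable A ->
  unif01 A = lebesgue_measure (A `&` `[0, 1[).
Proof.
move=> mA; rewrite /unif01 /= /uniform_prob integral_uniform_pdf.
transitivity (\int[lebesgue_measure]_(x in A `&` `[0%R, 1%R]) (1 : \bar R))%E.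
  apply: eq_integral => x; rewrite inE /= in_itv /= => -[_ x01].
  by rewrite /uniform_pdf x01 subr0 invr1.
rewrite integral_cst ?mul1e; last exact: measurableI.
have sE : A `&` `[0, 1] = (A `&` `[0, 1[) `|` (A `&` [set 1]).
  by rewrite -setIUr setUitv1 // bnd_simp.
apply/eqP; rewrite eq_le; apply/andP; split; last first.
  apply: le_measure; rewrite ?inE; [exact: measurableI|exact: measurableI|].
  by apply: setIS => x /=; rewrite !in_itv /= => /andP[-> /ltW].
rewrite sE (le_trans (measureU2 _ _ _))//.
- exact: measurableI.
- exact: measurableI.
rewrite -[leRHS]adde0 leeD2l// -(lebesgue_measure_set1 (1 : R)).
by apply: le_measure; rewrite ?inE//; exact: measurableI.
Qed.

Lemma lebesgue_measureD (a : R) (A : set (measurableTypeR R)) :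
  measurable A ->
  lebesgue_measure ((fun x => x + a) @^-1` A) = lebesgue_measure A.
Proof.
move=> mA.
have mf : measurable_fun setT
    ((fun x => x + a) : measurableTypeR R -> measurableTypeR R).
  by apply: measurable_funD.
pose m := [the measure _ _ of pushforward lebesgue_measure
    ((fun x => x + a) : measurableTypeR R -> measurableTypeR R)].
apply/esym.
rewrite (@lebesgue_measure_unique _ (m mf))//= => _ [[x y]] _ <-.
rewrite /pushforward.
rewrite (_ : _ @^-1` _ = `]x - a, y - a]%classic); last first.
  by apply/seteqP; split => z /=; rewrite !in_itv /= ltrBlDr lerBrDr.
by rewrite /= !lebesgue_measure_itv/= !lte_fin ltrD2r -!EFinB opprB addrA subrK.
Qed.

(* Rotation invariance of the uniform law, in terms of 1-periodic sets. *)
Lemma unif01_periodic (B : set (measurableTypeR R)) (a : R) :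
  measurable B -> (forall x, B (x + 1) <-> B x) ->
  unif01 ((fun x => x + a) @^-1` B) = unif01 B.
Proof.
move=> mB B1.
have BD1 (n : nat) x : B (x + n%:R) <-> B x.
  by elim: n => [|n IH]; rewrite ?addr0// -natr1 addrA B1.
have Bz (k : int) x : B (x + k%:~R) <-> B x.
  case: k => n; first exact: BD1.
  by rewrite NegzE mulrNz -(BD1 n.+1 (x - _)) subrK.
have mI (x y : R) : measurable (B `&` (`[x, y[ : set (measurableTypeR R))).
  exact: measurableI.
have mtr : measurable ((fun x : measurableTypeR R => x + a) @^-1` B).
  rewrite -[X in measurable X]setTI.
  by apply: (_ : measurable_fun setT _) => //; apply: measurable_funD.
rewrite !unif01E//; set n := Num.floor a.
have /andP[na an] : n%:~R <= a < (n + 1)%:~R by exact: floor_itv.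
rewrite intrD in an.
transitivity (lebesgue_measure (B `&` `[a, a + 1[)).
  rewrite -(lebesgue_measureD a (mI _ _)); congr lebesgue_measure.
  apply/seteqP; split => x /=; rewrite !in_itv /= lerDr (addrC a) ltrD2r.
    by move=> [].
  by move=> [].
transitivity (lebesgue_measure (B `&` `[n%:~R, n%:~R + 1[)); last first.
  rewrite -(lebesgue_measureD n%:~R (mI _ _)); congr lebesgue_measure.
  apply/seteqP; split => x /=; rewrite !in_itv /= lerDr (addrC n%:~R) ltrD2r.
    by move=> [/Bz].
  by move=> [Bx ?]; split => //; apply/Bz.
have split_itv (x y z : R) : x <= y -> y <= z ->
    lebesgue_measure (B `&` `[x, z[) =
    (lebesgue_measure (B `&` `[x, y[) + lebesgue_measure (B `&` `[y, z[))%E.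
  move=> xy yz; rewrite -measureU//.
    rewrite -setIUr; congr (lebesgue_measure (B `&` _)).
    apply/seteqP; split => u /=; rewrite !in_itv /=.
      by case: (ltP u y) => uy /andP[xu uz]; [left; rewrite xu|right].
    by move=> [|] /andP[u1 u2]; apply/andP; split; lra.
  by apply/seteqP; split => u //= -[[_ +] [_]]; rewrite !in_itv /=; lra.
rewrite (@split_itv a (n%:~R + 1)); [|lra|lra].
rewrite (@split_itv n%:~R a); [|lra|lra].
rewrite addeC; congr (_ + _)%E.
rewrite -(lebesgue_measureD 1 (mI _ _)); congr lebesgue_measure.
apply/seteqP; split => x /=; rewrite !in_itv /= lerD2r ltrD2r.
  by move=> [/B1].
by move=> [Bx ?]; split => //; apply/B1.
Qed.

End UnitInterval.

Section Circle.
Context (R : realType).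

Definition circle : Type := {z : R[i] | `|z| == 1}.

HB.instance Definition _ := Choice.on circle.

Definition circle_coord (z : circle) : R * R :=
  (complex.Re (val z), complex.Im (val z)).

Definition cexpi (t : R) : R[i] := (cos t +i* sin t)%C.

Lemma norm_cexpi t : `|cexpi t| == 1.
Proof. by rewrite normc_def /= cos2Dsin2 sqrtr1. Qed.

Lemma cexpiD s t : cexpi (s + t) = cexpi s * cexpi t.
Proof. by apply/eqP; rewrite eq_complex /= cosD sinD eqxx /= addrC. Qed.

Definition circle_exp (t : R) : circle := exist _ (cexpi t) (norm_cexpi t).

HB.instance Definition _ := isPointed.Build circle (circle_exp 0).

(* Borel sigma-algebra, as the trace of that of the plane. *)
HB.instance Definition _ := Measurable.copy circle
  (g_sigma_algebra_preimageType circle_coord).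

Lemma measurable_circle_coord : measurable_fun setT circle_coord.
Proof. by move=> _ A mA; exists A. Qed.

Lemma measurable_to_circle d (T : measurableType d) (f : T -> circle) :
  measurable_fun setT (circle_coord \o f) -> measurable_fun setT f.
Proof.
move=> mf _ _ [B mB <-]; rewrite setTI [X in measurable X](_ : _ =
  setT `&` (circle_coord \o f) @^-1` B); last by rewrite !setTI.
exact: mf.
Qed.

Definition circle_of_real (t : measurableTypeR R) : circle :=
  circle_exp (2 * pi * t).

Lemma measurable_circle_of_real : measurable_fun setT circle_of_real.
Proof.
apply: measurable_to_circle; apply: measurable_fun_pair => /=.
  apply: (measurableT_comp (continuous_measurable_fun (@continuous_cos R))).
  exact: measurable_funM.
apply: (measurableT_comp (continuous_measurable_fun (@continuous_sin R))).
exact: measurable_funM.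
Qed.

HB.instance Definition _ :=
  isMeasurableFun.Build _ _ _ _ circle_of_real measurable_circle_of_real.

Lemma circle_of_realD1 t : circle_of_real (t + 1) = circle_of_real t.
Proof.
apply/val_inj; rewrite /= /cexpi.
have -> : 2 * pi * (t + 1) = 2 * pi * t + pi *+ 2 :> R by ring.
by rewrite cosD2pi sinD2pi.
Qed.

(* The rotation-invariant (see [rotate_pushforward]) probability measure. *)
Definition circle_haar : probability circle R :=
  distribution (unif01 R) circle_of_real.

Lemma rotate_subproof (theta : R) (z : circle) :
  `|cexpi (2 * pi * theta) * val z| == 1.
Proof. by rewrite normrM (eqP (norm_cexpi _)) (eqP (valP z)) mulr1. Qed.

(* z |-> e^(2 i pi theta) z *)
Definition rotate (theta : R) (z : circle) : circle :=
  exist _ (cexpi (2 * pi * theta) * val z) (rotate_subproof theta z).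

Lemma rotateD s t z : rotate s (rotate t z) = rotate (s + t) z.
Proof. by apply/val_inj; rewrite /= (mulrDr (2 * pi)) cexpiD mulrA. Qed.

Lemma rotate0 z : rotate 0 z = z.
Proof.
by apply/val_inj; rewrite /= mulr0 /cexpi cos0 sin0; exact: mul1r.
Qed.

Lemma rotateK theta : cancel (rotate theta) (rotate (- theta)).
Proof. by move=> z; rewrite rotateD addNr rotate0. Qed.

Lemma rotateVK theta : cancel (rotate (- theta)) (rotate theta).
Proof. by move=> z; rewrite rotateD subrr rotate0. Qed.

Lemma measurable_rotate theta : measurable_fun setT (rotate theta).
Proof.
apply: measurable_to_circle; set a := 2 * pi * theta.
rewrite (_ : _ \o _ = (fun p : R * R =>
    (cos a * p.1 - sin a * p.2, cos a * p.2 + sin a * p.1)) \o circle_coord).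
  apply: measurableT_comp measurable_circle_coord.
  apply: measurable_fun_pair => /=.
    by apply: measurable_funB; apply: measurable_funM.
  by apply: measurable_funD; apply: measurable_funM.
by apply/funext => -[[x y] ?].
Qed.

Lemma rotate_pushforward theta A :
  measurable A -> pushforward circle_haar (rotate theta) A = circle_haar A.
Proof.
move=> mA; rewrite /pushforward /circle_haar /= /distribution /pushforward.
have mB : measurable (circle_of_real @^-1` A).
  by rewrite -[X in measurable X]setTI; exact: measurable_circle_of_real.
rewrite -[RHS](@unif01_periodic R _ theta mB); last first.
  by move=> x /=; rewrite circle_of_realD1.
congr (unif01 R _); apply/seteqP.
have E x : rotate theta (circle_of_real x) = circle_of_real (x + theta).
  by apply/val_inj; rewrite /= -cexpiD -mulrDr addrC.
by split => x /=; rewrite E.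
Qed.

Definition rotation (theta : R) : aut circle_haar :=
  MPIso (rotateK theta) (rotateVK theta) (measurable_rotate theta)
        (measurable_rotate (- theta)) (@rotate_pushforward theta).

End Circle.

Section Odometer.
Local Open Scope nat_scope.
Context (q : nat -> nat) (q_ge2 : forall n, 2 <= q n).

Definition odo_space of (forall n, 2 <= q n) : Type := forall n, 'I_(q n).

Local Notation Y := (odo_space q_ge2).

Definition digit (n m : nat) : 'I_(q n) :=
  Ordinal (ltn_pmod m (ltnW (q_ge2 n))).

HB.instance Definition _ := gen_eqMixin Y.
HB.instance Definition _ := gen_choiceMixin Y.
HB.instance Definition _ := isPointed.Build Y (fun n => digit n 0).

Definition coordinate_sets : set (set Y) :=
  [set A | exists n (B : set 'I_(q n)), A = [set x | B (x n)]].

(* Product of the discrete sigma-algebras. *)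
HB.instance Definition _ := Measurable.copy Y
  (g_sigma_algebraType coordinate_sets).

(* The carry into the digit of index n when adding 1 to that of index 0. *)
Fixpoint carry (x : Y) (n : nat) : nat :=
  if n is m.+1 then (x m + carry x m) %/ q m else 1.

Definition odo_succ (x : Y) : Y := fun n => digit n (x n + carry x n).

Fixpoint borrow (x : Y) (n : nat) : nat :=
  if n is m.+1 then x m < borrow x m else 1.

Definition odo_pred (x : Y) : Y := fun n => digit n (x n + q n - borrow x n).

Lemma carry_le1 x n : carry x n <= 1.
Proof.
elim: n => //= n IH; rewrite -ltnS ltn_divLR ?(ltnW (q_ge2 n))//.
by have := ltn_ord (x n); have := q_ge2 n; lia.
Qed.

Lemma borrow_le1 x n : borrow x n <= 1.
Proof. by case: n => //= n; case: ltnP. Qed.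

Lemma digit_succ p m b : 1 < p -> m < p -> b <= 1 ->
  ((m + b) %% p < b = (m + b) %/ p :> nat) /\
  ((m + b) %% p + p - b) %% p = m.
Proof.
move=> p1 mp b1; have [mbp|mbp] := ltnP (m + b) p.
  rewrite modn_small// divn_small//; split; first by case: ltnP => //; lia.
  by rewrite (_ : m + b + p - b = m + p) ?modnDr ?modn_small//; lia.
have -> : m + b = p by lia.
have -> : b = 1 by lia.
by rewrite modnn divnn (ltnW p1) add0n modn_small; lia.
Qed.

Lemma digit_pred p m b : 1 < p -> m < p -> b <= 1 ->
  ((m + p - b) %% p + b) %/ p = (m < b) /\
  ((m + p - b) %% p + b) %% p = m.
Proof.
move=> p1 mp b1; have [mb|bm] := ltnP m b.
  have -> : m = 0 by lia.
  have -> : b = 1 by lia.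
  by rewrite add0n modn_small ?subn1 ?addn1 ?prednK ?divnn ?modnn; lia.
rewrite (_ : m + p - b = m - b + p); last by lia.
rewrite modnDr modn_small; last by lia.
by rewrite subnK// divn_small// modn_small.
Qed.

Lemma borrow_succ x n : borrow (odo_succ x) n = carry x n.
Proof.
elim: n => //= n ->.
by have [] := digit_succ (q_ge2 n) (ltn_ord (x n)) (carry_le1 x n).
Qed.

Lemma carry_pred x n : carry (odo_pred x) n = borrow x n.
Proof.
elim: n => //= n ->.
by have [] := digit_pred (q_ge2 n) (ltn_ord (x n)) (borrow_le1 x n).
Qed.

Lemma odo_succK : cancel odo_succ odo_pred.
Proof.
move=> x; apply: functional_extensionality_dep => n; apply/val_inj => /=; rewrite borrow_succ.
by have [] := digit_succ (q_ge2 n) (ltn_ord (x n)) (carry_le1 x n).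
Qed.

Lemma odo_predK : cancel odo_pred odo_succ.
Proof.
move=> x; apply: functional_extensionality_dep => n; apply/val_inj => /=; rewrite carry_pred.
by have [] := digit_pred (q_ge2 n) (ltn_ord (x n)) (borrow_le1 x n).
Qed.

Definition cylinder (n : nat) (w : Y) : set Y :=
  [set x | forall k, k < n -> x k = w k].

Lemma measurable_coordinate n (B : set 'I_(q n)) :
  measurable ([set x | B (x n)] : set Y).
Proof. by apply: sub_sigma_algebra; exists n, B. Qed.

Lemma cylinderE n w :
  cylinder n w = \bigcap_(k in `I_n) [set x : Y | x k = w k].
Proof. by apply/seteqP; split => x /= h k; exact: h. Qed.

Lemma measurable_cylinder n w : measurable (cylinder n w).
Proof.
rewrite cylinderE; apply: fin_bigcap_measurable => // k _.
exact: (measurable_coordinate [set w k]).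
Qed.

Definition agree (n : nat) (x y : Y) := forall k, k < n -> x k = y k.

Definition cylinders : set (set Y) :=
  [set A | A = set0 \/ exists n w, A = cylinder n w].

Lemma finite_cylinders n : finite_set (range (cylinder n)).
Proof.
elim: n => [|n IH].
  apply: (@sub_finite_set _ _ [set setT]) => // _ [w _ <-] /=.
  by apply/seteqP; split.
apply: (@sub_finite_set _ _ ((fun p => p.1 `&` p.2) @`
    (range (cylinder n) `*` range (fun j : 'I_(q n) => [set x : Y | x n = j])))).
  move=> _ [w _ <-]; exists (cylinder n w, [set x : Y | x n = w n]).
    by split; [exists w|exists (w n)].
  apply/seteqP; split => x /=.
    by move=> [h1 h2] k; rewrite ltnS leq_eqVlt => /predU1P[->//|]; exact: h1.
  by move=> h; split => [k kn|]; apply: h => //; exact: ltnW.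
by apply: finite_image; apply: finite_setX => //; apply: finite_image.
Qed.

Lemma determined_cylinders n (A : set Y) :
  (forall x y, agree n x y -> A x -> A y) -> <<s cylinders >> A.
Proof.
move=> hA; pose D := [set C | range (cylinder n) C /\ C `<=` A].
rewrite (_ : A = \bigcup_(C in D) C); last first.
  apply/seteqP; split => [x Ax|x [C [_ CA] Cx]]; last exact: CA.
  exists (cylinder n x) => //; split; first by exists x.
  by move=> y xy; apply: hA Ax => k kn; rewrite xy.
apply: (@fin_bigcup_measurable _ (g_sigma_algebraType cylinders)).
  by apply: sub_finite_set (finite_cylinders n) => C [].
move=> C [[w _ <-] _]; apply: sub_sigma_algebra; right.
by exists n, w.
Qed.

Lemma cylinders_measurable : cylinders `<=` measurable.
Proof. by move=> _ [->|[n [w ->]]] //; exact: measurable_cylinder. Qed.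

Lemma measurable_odo_spaceE : measurable = <<s cylinders >>.
Proof.
apply/seteqP; split.
  apply: smallest_sub; first exact: smallest_sigma_algebra.
  move=> _ [n [B ->]]; apply: (@determined_cylinders n.+1) => x y xy /=.
  by rewrite xy.
by apply: smallest_sub cylinders_measurable; exact: sigma_algebra_measurable.
Qed.

Lemma cylinders_setI : setI_closed cylinders.
Proof.
move=> A B [->|[n [w ->]]]; first by left; rewrite set0I.
move=> [->|[m [v ->]]]; first by left; rewrite setI0.
have [->|/set0P[x [xw xv]]] := eqVneq (cylinder n w `&` cylinder m v) set0.
  by left.
right; exists (maxn n m), x; apply/seteqP; split => y /=.
  move=> [yw yv] k; rewrite leq_max => /orP[kn|km].
    by rewrite yw// xw.
  by rewrite yv// xv.
move=> yx; split => k h; rewrite yx ?leq_max ?h ?orbT//; [exact: xw|exact: xv].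
Qed.

Lemma odo_succ_agree n x y : agree n x y -> agree n (odo_succ x) (odo_succ y).
Proof.
move=> xy k kn; rewrite /odo_succ xy//; congr (digit _ (_ + _)).
elim: k kn => //= k IH kn; have kn' := ltnW kn.
by rewrite xy// IH.
Qed.

Lemma odo_pred_agree n x y : agree n x y -> agree n (odo_pred x) (odo_pred y).
Proof.
move=> xy k kn; rewrite /odo_pred xy//; congr (digit _ (_ - _)).
elim: k kn => //= k IH kn; have kn' := ltnW kn.
by rewrite xy// IH.
Qed.

Lemma measurable_agree (f : Y -> Y) :
  (forall n x y, agree n x y -> agree n (f x) (f y)) ->
  measurable_fun setT f.
Proof.
move=> hf; apply: (measurability coordinate_sets) => //.
move=> _ [A [n [B AE]] <-]; rewrite AE measurable_odo_spaceE setTI.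
by apply: (@determined_cylinders n.+1) => x y /hf /= ->.
Qed.

Section OdoMeasure.
Context (R : realType).

Definition odo_of_real (t : measurableTypeR R) : Y :=
  fun n => digit n (Num.truncn (t * (\prod_(k < n.+1) q k)%:R)%R).

Lemma measurable_truncn (a : R) (B : set nat) :
  measurable [set t : measurableTypeR R | B (Num.truncn (t * a)%R)].
Proof.
have ma m : measurable [set t : measurableTypeR R | Num.truncn (t * a)%R <= m].
  rewrite (_ : mkset _ = setT `&` (fun t => t * a)%R @^-1` `]-oo, m.+1%:R[).
    by apply: (_ : measurable_fun setT _) => //; exact: measurable_funM.
  by rewrite setTI; apply/seteqP; split => t /=; rewrite in_itv/= truncn_le_nat.
rewrite (_ : mkset _ =
  \bigcup_(m in B) [set t : measurableTypeR R | Num.truncn (t * a)%R = m]).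
  apply: bigcup_measurable => -[|m] _.
    rewrite (_ : mkset _ = [set t | Num.truncn (t * a)%R <= 0])//.
    by apply/seteqP; split => t /=; rewrite leqn0 => /eqP.
  rewrite (_ : mkset _ = [set t | Num.truncn (t * a)%R <= m.+1] `\`
    [set t | Num.truncn (t * a)%R <= m]); first exact: measurableD.
  apply/seteqP; split => t /= => [->|[]]; first by split => //; lia.
  by lia.
by apply/seteqP; split => [t Bt|t [m Bm /= ->]] //; exists (Num.truncn (t * a)%R).
Qed.

Lemma measurable_odo_of_real : measurable_fun setT odo_of_real.
Proof.
apply: (measurability coordinate_sets) => //.
move=> _ [A [n [B AE]] <-]; rewrite AE setTI.
exact: (measurable_truncn _ [set m | B (digit n m)]).
Qed.

HB.instance Definition _ :=
  isMeasurableFun.Build _ _ _ _ odo_of_real measurable_odo_of_real.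

(* The product of the uniform measures, obtained as the law of the digits of a
   uniform real number in the mixed radix q and characterised by
   [odo_measure_cylinder]. *)
Definition odo_measure : probability Y R := distribution (unif01 R) odo_of_real.

Fixpoint prefix_value (w : Y) (n : nat) : nat :=
  if n is m.+1 then prefix_value w m * q m + w m else 0.

Lemma truncn_mul_divn (s : R) c : 0 < c -> (0 <= s)%R ->
  Num.truncn (s * c%:R)%R %/ c = Num.truncn s.
Proof.
move=> c0 s0.
have E m : (m <= Num.truncn (s * c%:R)%R %/ c) = (m <= Num.truncn s).
  rewrite leq_divRL// !truncn_ge_nat ?mulr_ge0// natrM.
  by rewrite ler_pM2r// ltr0n.
by apply/eqP; rewrite eqn_leq -E leqnn /= E.
Qed.

Lemma cylinderS n w x : cylinder n.+1 w x <-> cylinder n w x /\ x n = w n.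
Proof.
split=> [h|[h1 h2] k].
  by split => [k kn|]; apply: h => //; exact: ltnW.
by rewrite ltnS leq_eqVlt => /predU1P[->//|]; exact: h1.
Qed.

Lemma odo_of_real_cylinder n w (t : R) : (0 <= t)%R ->
  (cylinder n w (odo_of_real t) /\ (t < 1)%R) <->
  Num.truncn (t * (\prod_(k < n) q k)%:R)%R = prefix_value w n.
Proof.
move=> t0; elim: n => [|n IH].
  rewrite big_ord0 mulr1; split=> [[_ t1]|/= /eqP].
    by apply/eqP; rewrite -leqn0 -ltnS truncn_lt_nat.
  by rewrite -leqn0 -ltnS truncn_lt_nat.
have [qn0 wn] := (ltnW (q_ge2 n), ltn_ord (w n)).
have Q0 : (0 <= t * (\prod_(k < n) q k)%:R)%R by rewrite mulr_ge0.
have D := truncn_mul_divn qn0 Q0.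
have E : odo_of_real t n = w n <->
    Num.truncn (t * (\prod_(k < n.+1) q k)%:R)%R %% q n = w n.
  by split => [<-//|h]; apply/val_inj.
have -> : (cylinder n.+1 w (odo_of_real t) /\ (t < 1)%R) <->
    (cylinder n w (odo_of_real t) /\ (t < 1)%R) /\ odo_of_real t n = w n.
  by rewrite cylinderS; tauto.
rewrite IH E big_ord_recr /= natrM mulrA; set N := Num.truncn (_ * (q n)%:R)%R.
rewrite -D -/N; split=> [[<- <-]|->]; first by rewrite -divn_eq.
by rewrite divnMDl// divn_small// addn0 modnMDl modn_small.
Qed.

Lemma odo_measure_cylinder n w :
  odo_measure (cylinder n w) = (\prod_(k < n) (q k)%:R^-1)%:E%R.
Proof.
have mc : measurable (odo_of_real @^-1` cylinder n w).
  rewrite -[X in measurable X]setTI; apply: measurable_odo_of_real => //.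
  exact: measurable_cylinder.
rewrite /odo_measure /= /distribution /pushforward unif01E//.
set Q := (\prod_(k < n) q k); set M := prefix_value w n.
have Q0 : (0 < Q%:R :> R)%R.
  by rewrite ltr0n prodn_gt0// => k; exact: ltnW.
rewrite (_ : _ `&` _ = `[M%:R / Q%:R, M.+1%:R / Q%:R[%classic%R); last first.
  have E (t : R) : (0 <= t)%R -> (Num.truncn (t * Q%:R)%R = M <->
      (M%:R / Q%:R <= t < M.+1%:R / Q%:R)%R).
    move=> t0; rewrite ler_pdivrMr// ltr_pdivlMr//.
    by rewrite -truncn_eq ?mulr_ge0 ?ler0n//; split => /eqP.
  apply/seteqP; split => t /=; rewrite !in_itv /=.
    by move=> [tw /andP[t0 t1]]; apply/E => //; apply/odo_of_real_cylinder.
  move=> tM; have t0 : (0 <= t)%R.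
    by move/andP: tM => [+ _]; apply: le_trans; rewrite divr_ge0 ?ler0n.
  by rewrite t0; move/E: tM => /(_ t0)/odo_of_real_cylinder[].
rewrite lebesgue_measure_itv/= lte_fin ltr_pM2r ?invr_gt0// ltr_nat ltnSn.
by rewrite -EFinB -mulrBl -natrB// subSnn mul1r prodfV -natr_prod.
Qed.

Lemma odo_succ_pushforward A :
  measurable A -> pushforward odo_measure odo_succ A = odo_measure A.
Proof.
move=> mA.
have ms : measurable_fun setT odo_succ by exact: (measurable_agree odo_succ_agree).
pose m := [the measure _ _ of pushforward odo_measure odo_succ].
rewrite -[LHS]/(m ms A).
apply: (measure_unique cylinders (fun=> setT)) => //.
- exact: measurable_odo_spaceE.
- exact: cylinders_setI.
- by move=> _; right; exists 0, point; apply/seteqP; split.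
- by apply/seteqP; split => // x _; exists 0.
- move=> B [->|[n [w ->]]]; first by rewrite !measure0.
  have E : odo_succ @^-1` cylinder n w = cylinder n (odo_pred w).
    apply/seteqP; split => x /= xw.
      by rewrite -(odo_succK x); exact: odo_pred_agree.
    by rewrite -(odo_predK w); exact: odo_succ_agree.
  transitivity (odo_measure (cylinder n (odo_pred w))); first by rewrite -E.
  by rewrite odo_measure_cylinder; exact/esym/odo_measure_cylinder.
- by move=> _; rewrite /m /= /pushforward preimage_setT probability_setT ltry.
Qed.

Definition odometer : aut odo_measure :=
  MPIso odo_succK odo_predK (measurable_agree odo_succ_agree)
        (measurable_agree odo_pred_agree) odo_succ_pushforward.

End OdoMeasure.

End Odometer.

(* Every prime has infinite multiplicity among the factors of the q n. *)
Definition universal (q : nat -> nat) :=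
  forall p, prime p -> forall m, exists n, (m <= \sum_(k < n) logn p (q k))%N.

(* Main.v *)
(* Take theta = p_0 / Q_0 + sum_(N > 0) 1 / Q_N with Q_N^2 | Q_(N+1) and Q_N
   growing fast.  The partial sums alpha_N = p_N / Q_N are in lowest terms, so the
   rotation by alpha_N permutes the Q_N arcs [g / Q_N, (g + 1) / Q_N[ cyclically;
   let t_N(z) be the time at which the cycle starting from the arc 0 reaches the
   arc of z.  The quotient of t_(N+1) by Q_N is the same for z and for its image by
   the rotation by theta, except on a set of measure O(1 / Q_N).  Pairing the
   digits of the odometer with these quotients thus identifies the circle with
   the odometer, up to a countable set.

   The residue v_N of the odometer modulo Q_N and the time t_N determine each
   other, and |v_N - t_N| < Q_(N-1) since they have the same quotient by Q_(N-1).
   Outside a bad set B_N of measure O(Q_(N-1) / Q_N), both maps leave the quotients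
   of level N unchanged.  Hence a point which lies in no B_M with M > N has
   cocycles bounded by 2 Q_N: the integrals of phi of the cocycles are at most
   O(1) + sum_N phi(2 Q_N) Q_(N-1) / Q_N, which converges if Q_N is chosen large
   enough after Q_(N-1), as soon as phi is sublinear. *)
Require Import Defs.
From mathcomp Require Import all_boot all_order all_algebra.
From mathcomp Require Import ring lra zify.
From mathcomp Require Import complex.
From mathcomp Require Import all_classical all_reals all_analysis.
From mathcomp Require Import measurable_realfun.

Set Implicit Arguments.
Unset Strict Implicit.
Unset Printing Implicit Defensive.

Import Order.TTheory GRing.Theory Num.Theory.
Import numFieldNormedType.Exports.

Local Open Scope classical_set_scope.
Local Open Scope ring_scope.

(** * Arithmetic of towers *)

(* Level N cuts the circle into [height N] equal arcs, which the rotation by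
   [numer N / height N] permutes cyclically; each arc is then cut into
   [height N * ratio N] arcs, and the angle grows by [1 / height N.+1]. *)
Record tower := Tower {
  height : nat -> int ;
  ratio : nat -> int ;
  numer : nat -> int ;
  inv_numer : nat -> int ;
  height0_gt0 : 0 < height 0 ;
  ratio_ge2 : forall N, 2 <= ratio N ;
  heightS : forall N, height N.+1 = height N * (height N * ratio N) ;
  numerS : forall N, numer N.+1 = numer N * (height N * ratio N) + 1 ;
  inv_numerP : forall N, (inv_numer N * numer N = 1 %[mod height N])%Z }.

Section TowerArithmetic.
Variable W : tower.
Local Notation Q := (height W).
Local Notation l := (ratio W).
Local Notation p := (numer W).
Local Notation u := (inv_numer W).

Definition cuts N : int := Q N * l N.
Local Notation k := cuts.

Lemma height_gt0 N : 0 < Q N.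
Proof.
elim: N => [|N IH]; first exact: height0_gt0.
by rewrite heightS; have := ratio_ge2 W N; nia.
Qed.
Hint Resolve height_gt0 : core.

Lemma height_ge0 N : 0 <= Q N. Proof. exact: ltW. Qed.
Lemma height_neq0 N : Q N != 0. Proof. by rewrite gt_eqF. Qed.
Hint Resolve height_ge0 height_neq0 : core.

Lemma cuts_ge2 N : 2 <= k N.
Proof. by rewrite /k; have := ratio_ge2 W N; have := height_gt0 N; nia. Qed.

Lemma cuts_gt0 N : 0 < k N. Proof. by have := cuts_ge2 N; lia. Qed.
Hint Resolve cuts_gt0 : core.

Lemma height_le_cuts N : Q N <= k N.
Proof. by rewrite /k; have := ratio_ge2 W N; have := height_gt0 N; nia. Qed.

Lemma heightSk N : Q N.+1 = Q N * k N. Proof. exact: heightS. Qed.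

Lemma height_ge_expn N : (2 ^ N)%N%:Z <= Q N.
Proof.
elim: N => [|N IH]; first by have := height_gt0 0; rewrite expn0; lia.
by rewrite heightSk expnS; have := cuts_ge2 N; nia.
Qed.

Lemma ltn_height N : N%:Z < Q N.
Proof. by apply: lt_le_trans (height_ge_expn N); rewrite ltz_nat ltn_expl. Qed.

Lemma dvdz_height N M : (N <= M)%N -> (Q N %| Q M)%Z.
Proof.
move=> /subnK <-; elim: (M - N)%N => //= m IH; apply: (dvdz_trans IH).
by rewrite addSn heightSk dvdz_mulr.
Qed.

Lemma height_cuts_dvd N : (Q N %| k N)%Z. Proof. exact: dvdz_mulr. Qed.

Lemma divmodz (d a r : int) : 0 <= r < d ->
  (((r + d * a) %/ d)%Z = a) * (((r + d * a) %% d)%Z = r).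
Proof.
move=> rd; have d0 : d != 0 by lia.
by rewrite addrC mulrC divzMDl// modzMDl modz_small// divz_small ?addr0//; lia.
Qed.

Lemma modz_range (d : int) x : 0 < d -> 0 <= (x %% d)%Z < d.
Proof. by move=> d0; rewrite modz_ge0 ?gt_eqF// ltz_pmod. Qed.

Lemma modz_dvd (d e : int) x : (d %| e)%Z -> ((x %% e)%Z %% d)%Z = (x %% d)%Z.
Proof.
move=> /dvdzP[c ->]; rewrite {2}(divz_eq x (c * d)) mulrA.
by rewrite modzMDl.
Qed.

Lemma divz_range (d e : int) x : 0 < d -> 0 <= x < d * e -> 0 <= (x %/ d)%Z < e.
Proof. by move=> d0 xe; rewrite divz_ge0// ltz_divLR//; lia. Qed.

(* The arc visited at time t of the cycle of level N.+1 lies in the arc of level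
   N visited at this time. *)
Definition lower_time N (t : int) : int := ((t + (t %/ k N)%Z * u N) %% Q N)%Z.
Local Notation h := lower_time.

Lemma lower_time_range N t : 0 <= h N t < Q N.
Proof. exact: modz_range. Qed.

(* The residue modulo [height N] of the odometer paired with the arc visited at
   time t.  Keeping the quotient by [height M] makes values and times close. *)
Fixpoint value_of_time N (t : int) : int :=
  if N is M.+1 then value_of_time M (h M t) + Q M * (t %/ Q M)%Z else t.
Local Notation vt := value_of_time.

(** Inverse of [value_of_time] on residues: the shift made by [lower_time] is undone with
    [v %/ k M], which is also the quotient of the time. *)
Fixpoint time_of_value N (v : int) : int :=
  if N is M.+1 then
    ((time_of_value M (v %% Q M)%Z - (v %/ k M)%Z * u M) %% Q M)%Z
      + Q M * (v %/ Q M)%Z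
  else v.
Local Notation tv := time_of_value.

Lemma value_of_time_range N t : 0 <= t < Q N -> 0 <= vt N t < Q N.
Proof.
elim: N t => //= N IH t; rewrite heightSk => tQ.
have := divz_range (height_gt0 N) tQ; have := IH _ (lower_time_range N t).
by have := height_gt0 N; nia.
Qed.

Lemma value_of_timeS N t :
  ((vt N.+1 t %/ Q N)%Z = (t %/ Q N)%Z) * ((vt N.+1 t %% Q N)%Z = vt N (h N t)).
Proof. by rewrite /= !divmodz// value_of_time_range// lower_time_range. Qed.

(** Times and values share their quotient by [Q N], hence also the quotient by [k N] that enters
    [lower_time]. This makes [value_of_time] invertible. *)
Lemma divz_cuts N t : (t %/ k N)%Z = ((t %/ Q N)%Z %/ l N)%Z.
Proof. by rewrite divzMA_ge0. Qed.

Lemma time_of_valueS N v :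
  ((tv N.+1 v %/ Q N)%Z = (v %/ Q N)%Z) *
  ((tv N.+1 v %% Q N)%Z =
     ((tv N (v %% Q N)%Z - (v %/ k N)%Z * u N) %% Q N)%Z).
Proof. by rewrite /= !divmodz// modz_range. Qed.

Lemma time_of_value_range N v : 0 <= v < Q N -> 0 <= tv N v < Q N.
Proof.
elim: N v => //= N IH v; rewrite heightSk => vQ.
have := divz_range (height_gt0 N) vQ.
have := modz_range (tv N (v %% Q N)%Z - (v %/ k N)%Z * u N) (height_gt0 N).
by have := height_gt0 N; nia.
Qed.

Lemma value_of_timeK N t : 0 <= t < Q N -> tv N (vt N t) = t.
Proof.
elim: N t => // N IH t tQ.
rewrite (divz_eq (tv _ _) (Q N)) !time_of_valueS !value_of_timeS.
rewrite IH ?lower_time_range//.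
rewrite (_ : (vt N.+1 t %/ k N)%Z = (t %/ k N)%Z); last first.
  by rewrite divz_cuts value_of_timeS -divz_cuts.
by rewrite modzDml addrK -divz_eq.
Qed.

Lemma time_of_valueK N v : 0 <= v < Q N -> vt N (tv N v) = v.
Proof.
elim: N v => // N IH v vQ.
rewrite (divz_eq (vt _ _) (Q N)) !value_of_timeS !time_of_valueS.
have e : h N (tv N.+1 v) = tv N (v %% Q N)%Z.
  rewrite /h (_ : (tv N.+1 v %/ k N)%Z = (v %/ k N)%Z); last first.
    by rewrite divz_cuts time_of_valueS -divz_cuts.
  rewrite -modzDml time_of_valueS modzDml subrK modz_small//.
  by apply: time_of_value_range; exact: modz_range.
by rewrite e IH ?modz_range// -divz_eq.
Qed.

(** Both have the same quotient by [Q N], so only their remainders differ. *)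
Lemma value_time_dist N t : 0 <= t < Q N.+1 -> `|vt N.+1 t - t| < Q N.
Proof.
move=> tQ; rewrite {2}(divz_eq t (Q N)) /=.
have := value_of_time_range (lower_time_range N t).
have := modz_range t (height_gt0 N); set a := (_ %/ _)%Z.
by rewrite mulrC; lia.
Qed.

(* Arcs are numbered counterclockwise: that visited at time t is t * numer N. *)
Definition time_of_arc N (g : int) : int := ((u N * g) %% Q N)%Z.

Lemma time_of_arc_range N g : 0 <= time_of_arc N g < Q N.
Proof. exact: modz_range. Qed.

Lemma time_of_arc_numer N g : ((p N * time_of_arc N g) %% Q N)%Z = (g %% Q N)%Z.
Proof.
rewrite /time_of_arc modzMmr mulrA (mulrC (p N)) -modzMml inv_numerP modzMml.
by rewrite mul1r.
Qed.

Lemma time_of_arc_mul N t :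
  time_of_arc N ((p N * t) %% Q N)%Z = (t %% Q N)%Z.
Proof.
rewrite /time_of_arc modzMmr mulrA -modzMml inv_numerP modzMml.
by rewrite mul1r.
Qed.

(** Write [t = b * k N + e]. Modulo [Q N.+1 = Q N * k N], the product
    [p N.+1 * t = p N * k N * t + t] is [e + k N * (p N * e + b)], because [Q N] divides [k N]. So
    the arc has position [e] inside an arc of level N, and [lower_time] is the time of the
    latter. *)
Lemma arcS N t :
  ((((p N.+1 * t) %% Q N.+1)%Z %% k N)%Z = (t %% k N)%Z) *
  ((((p N.+1 * t) %% Q N.+1)%Z %/ k N)%Z = ((p N * h N t) %% Q N)%Z).
Proof.
set e := (t %% k N)%Z; set b := (t %/ k N)%Z.
have tE : t = b * k N + e by exact: divz_eq.
have eR : 0 <= e < k N by exact: modz_range.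
suff -> : ((p N.+1 * t) %% Q N.+1)%Z = e + k N * ((p N * h N t) %% Q N)%Z.
  by rewrite !divmodz.
(* Modulo [Q N], the product [p N * u N] is 1 and [k N] is 0. *)
have hE : ((p N * h N t) %% Q N)%Z = ((e * p N + b) %% Q N)%Z.
  rewrite /h modzMmr -/b; apply/eqP; rewrite eqz_mod_dvd {1}tE.
  have /eqP := inv_numerP W N; rewrite eqz_mod_dvd => /dvdzP[c uE].
  have /dvdzP[d kE] := height_cuts_dvd N.
  have -> : p N * (b * k N + e + b * u N) - (e * p N + b) =
     p N * b * k N + b * (u N * p N - 1) by ring.
  by rewrite uE kE !mulrA -mulrDl; exact: dvdz_mull.
rewrite hE; set x := e * p N + b.
rewrite (_ : p N.+1 * t = (e + k N * (x %% Q N)%Z) + Q N.+1 *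
    ((x %/ Q N)%Z + b * p N * l N)); last first.
  have E : k N * x = k N * ((x %/ Q N)%Z * Q N + (x %% Q N)%Z).
    by rewrite -divz_eq.
  rewrite numerS -/(k N) heightSk.
  have -> : (p N * k N + 1) * t = k N * x + p N * b * k N * k N + e.
    by rewrite /x tE; ring.
  by rewrite E /k; ring.
rewrite addrC mulrC modzMDl modz_small// heightSk.
by have := modz_range x (height_gt0 N); have := cuts_gt0 N; nia.
Qed.

Lemma lower_time_of_arc N g : 0 <= g < Q N.+1 ->
  (h N (time_of_arc N.+1 g) = time_of_arc N (g %/ k N)%Z) *
  ((time_of_arc N.+1 g %% k N)%Z = (g %% k N)%Z).
Proof.
move=> gQ; have [<- E] := arcS N (time_of_arc N.+1 g).
rewrite time_of_arc_numer (modz_small gQ) in E *.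
split=> //; rewrite E time_of_arc_mul modz_small//; exact: lower_time_range.
Qed.

End TowerArithmetic.

(** * One step of either map, seen on times and on values *)

Section Dynamics.
Variable W : tower.
Local Notation Q := (height W).
Local Notation k := (cuts W).
Local Notation vt := (value_of_time W).

(** The trace of a point of the circle: the times of the nested arcs containing it. *)
Definition time_sequence (t : nat -> int) :=
  forall N, (0 <= t N < Q N) /\ lower_time W N (t N.+1) = t N.

(* The first two clauses are the ends of the cycles of the odometer and of the
   rotation at level N.+1, the third one is a drift of the rotation into the
   next arc, and the last ones a change of digit under a shift of time of size
   at most [2 * height N]. *)
Definition bad N (t : nat -> int) : bool :=
  [|| vt N.+1 (t N.+1) == Q N.+1 - 1,
      t N.+1 == Q N.+1 - 1,
      k N.+1 - 2 <= (t N.+2 %% k N.+1)%Z,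
      (t N.+2 %% Q N.+1)%Z < 2 * Q N
    | Q N.+1 - 2 * Q N <= (t N.+2 %% Q N.+1)%Z].

Lemma height_homo N M : (N <= M)%N -> Q N <= Q M.
Proof.
move=> /subnK <-; elim: (M - N)%N => //= m IH; apply: (le_trans IH).
rewrite addSn heightSk.
by have := height_gt0 W (m + N); have := cuts_ge2 W (m + N); nia.
Qed.

Variables t t' : nat -> int.
Hypotheses (tP : time_sequence t) (tP' : time_sequence t').

Lemma value_timeS N : vt N.+1 (t N.+1) = vt N (t N) + Q N * (t N.+1 %/ Q N)%Z.
Proof. by have [_ /= ->] := tP N. Qed.

Lemma shift_bound N (a b : int) :
  (0 <= a < Q N.+1) -> 0 <= b < Q N.+1 ->
  `|vt N.+1 a - vt N.+1 b| <= 1 -> `|a - b| <= 2 * Q N.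
Proof.
by move=> /value_time_dist + /value_time_dist; lia.
Qed.

Lemma divmodzD (x s d : int) : 0 < d -> 0 <= (x %% d)%Z + s < d ->
  (((x + s) %/ d)%Z = (x %/ d)%Z) * (((x + s) %% d)%Z = (x %% d)%Z + s).
Proof.
move=> d0 H; suff -> : x + s = ((x %% d)%Z + s) + d * (x %/ d)%Z.
  by rewrite !divmodz.
by rewrite {1}(divz_eq x d); ring.
Qed.

(** The case of the rotation. Away from the ends of cycles, times increase by 1 as integers. This
    leaves the quotients by [Q N] unchanged, so the increment of the value does not depend on the
    level. *)
Lemma values_shift n :
  (forall N, (n <= N)%N -> ~~ bad N t) ->
  (forall N, (n < N)%N -> (t' N = t N + 1 %[mod Q N])%Z) ->
  exists2 c : int, `|c| <= 2 * Q n &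
    forall N, (n < N)%N -> vt N (t' N) = vt N (t N) + c.
Proof.
move=> nbad tt1.
have tt' N : (n < N)%N -> t' N = t N + 1.
  case: N => // N nN; have := tt1 _ nN; have [tr _] := tP N.+1.
  have [tr' _] := tP' N.+1.
  rewrite modz_small// => ->; rewrite modz_small//.
  by have := nbad N nN; rewrite /bad; lia.
(* At level [n.+1] both values are within [Q n] of their times, and the times differ by 1. *)
exists (vt n.+1 (t' n.+1) - vt n.+1 (t n.+1)).
  have [tr _] := tP n.+1; have [tr' _] := tP' n.+1.
  have := value_time_dist tr; have := value_time_dist tr'.
  by have := tt' n.+1 (leqnn _); lia.
elim=> // N IH; rewrite ltnS leq_eqVlt => /predU1P[<-|nN].
  by rewrite addrC subrK.
move: (IH nN); set c := _ - _ => {}IH.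
rewrite value_timeS; have [_ /= ->] := tP' N; rewrite IH.
rewrite (_ : (t' N.+1 %/ Q N)%Z = (t N.+1 %/ Q N)%Z); first by ring.
rewrite tt'; last by rewrite ltnS ltnW.
(* [bad N] controls the time of level [N.+2] modulo [Q N.+1], whence the change of index. *)
case: N nN {IH} => // N nN; rewrite divmodzD ?height_gt0//.
have := modz_range (t N.+2) (height_gt0 W N.+1).
by have := nbad N nN; have := height_gt0 W N; rewrite /bad; lia.
Qed.

(** The case of the odometer, with times and values exchanged. Here the remainder of the next time
    is known only through [lower_time]. *)
Lemma times_shift n :
  (forall N, (n <= N)%N -> ~~ bad N t) ->
  (forall N, (n < N)%N -> (vt N (t' N) = vt N (t N) + 1 %[mod Q N])%Z) ->
  exists2 s : int, `|s| <= 2 * Q n &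
    forall N, (n < N)%N -> t' N = t N + s.
Proof.
move=> nbad vv1.
have vv' N : (n < N)%N -> vt N (t' N) = vt N (t N) + 1.
  case: N => // N nN; have := vv1 _ nN.
  have [/value_of_time_range vr _] := tP N.+1.
  have [/value_of_time_range vr' _] := tP' N.+1.
  rewrite modz_small// => ->; rewrite modz_small//.
  by have := nbad N nN; rewrite /bad; lia.
have sb : `|t' n.+1 - t n.+1| <= 2 * Q n.
  have [tr _] := tP n.+1; have [tr' _] := tP' n.+1.
  apply: shift_bound => //; rewrite vv'//; lia.
exists (t' n.+1 - t n.+1) => //.
elim=> // N IH; rewrite ltnS leq_eqVlt => /predU1P[<-|nN].
  by rewrite addrC subrK.
move: IH sb => /(_ nN); set s := _ - t n.+1 => IH sb.
(* Quotients of times are quotients of values, and [vt N (t N)] is not the last residue, since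
   adding 1 gives [vt N (t' N)]. *)
have dE : (t' N.+1 %/ Q N)%Z = (t N.+1 %/ Q N)%Z.
  have E x : (x %/ Q N)%Z = (vt N.+1 x %/ Q N)%Z by rewrite value_of_timeS.
  rewrite (E (t' _)) (E (t _)) vv'; last by rewrite ltnS ltnW.
  have [/value_of_time_range vr _] := tP N.
  have [/value_of_time_range vr' _] := tP' N.
  rewrite divmodzD ?height_gt0// value_of_timeS (proj2 (tP N)).
  by have := vv' _ nN; lia.
have bE : (t' N.+1 %/ k N)%Z = (t N.+1 %/ k N)%Z by rewrite !divz_cuts dE.
(* As the quotients by [k N] agree, the same multiple of [inv_numer] enters both lower times and
   cancels. The last two clauses of [bad] then prevent a wrap-around, as [|s| <= 2 * Q n]. *)
have mE : (t' N.+1 %% Q N)%Z = (t N.+1 %% Q N)%Z + s.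
  have hE : (t' N.+1 = t N.+1 + s %[mod Q N])%Z.
    apply/eqP; rewrite -(eqz_modDr ((t N.+1 %/ k N)%Z * inv_numer W N)).
    apply/eqP; rewrite -[in LHS]bE -/(lower_time W N (t' N.+1)).
    rewrite addrAC -modzDml -/(lower_time W N (t N.+1)).
    rewrite (proj2 (tP N)) (proj2 (tP' N)) IH modz_small//.
    by have [] := tP' N; rewrite IH.
  rewrite hE; case: N nN {IH dE bE hE} => // N nN.
  rewrite divmodzD ?height_gt0//.
  have := modz_range (t N.+2) (height_gt0 W N.+1).
  have := height_homo (nN : (n <= N)%N).
  by have := nbad N nN; rewrite /bad; lia.
by rewrite (divz_eq (t' _) (Q N)) dE mE [in RHS](divz_eq (t _) (Q N)) addrA.
Qed.

End Dynamics.

(** * The circle *)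

Section CircleArgument.
Variable R : realType.
Implicit Types (z : circle R) (t : R).

Lemma circle_coord_sqr z : (circle_coord z).1 ^+ 2 + (circle_coord z).2 ^+ 2 = 1.
Proof.
case: z => -[x y] /=; rewrite normc_def /= => /eqP[] /(congr1 (fun a => a ^+ 2)).
by rewrite sqr_sqrtr ?expr1n// addr_ge0 ?sqr_ge0.
Qed.

Lemma circle_coord_inj : injective (@circle_coord R).
Proof.
move=> [[x y] h] [[x' y'] h'] [/= xx' yy']; apply/val_inj => /=.
by rewrite xx' yy'.
Qed.

(** The argument measured in turns; the lower half circle is treated by reflection. *)
Definition arg z : R :=
  let: (x, y) := circle_coord z in
  if 0 <= y then acos x / (2 * pi) else 1 - acos x / (2 * pi).

Let pi2_gt0 : 0 < 2 * pi :> R. Proof. by rewrite mulr_gt0// pi_gt0. Qed.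
Let pi2_neq0 : 2 * pi != 0 :> R. Proof. by rewrite gt_eqF. Qed.

Lemma arg_range z : 0 <= arg z < 1.
Proof.
have := circle_coord_sqr z; rewrite /arg; case: circle_coord => x y /= xy.
have x1 : -1 <= x <= 1 by nra.
have a0 := acos_ge0 x1; have api := acos_lepi x1; have pi0 := pi_gt0 R.
case: ifPn => [y0|]; last rewrite -ltNge => y0.
  rewrite divr_ge0//= ?(ltW pi2_gt0)//.
  by rewrite ltr_pdivrMr// mul1r; lra.
have a1 : 0 < acos x by apply: acos_gt0; nra.
have : 0 < acos x / (2 * pi) <= 1.
  by rewrite divr_gt0//= ler_pdivrMr// mul1r; lra.
by lra.
Qed.

Lemma argK : cancel arg (@circle_of_real R).
Proof.
move=> z; apply: circle_coord_inj; rewrite /circle_of_real /= /circle_coord /=.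
have := circle_coord_sqr z; rewrite -/(circle_coord z) /arg.
case: circle_coord => x y /= xy.
have x1 : -1 <= x <= 1 by nra.
have xE : cos (acos x) = x by apply: acosK; rewrite in_itv.
have yE : sin (acos x) = `|y|.
  by rewrite sin_acos// (_ : 1 - x ^+ 2 = y ^+ 2) ?sqrtr_sqr//; lra.
case: ifPn => [y0|]; last rewrite -ltNge => y0.
  by rewrite mulrC divfK// xE yE ger0_norm.
rewrite mulrBr mulr1 [_ * (acos x / _)]mulrC divfK//.
rewrite (_ : 2 * pi = pi *+ 2); last by rewrite mulr_natl.
rewrite addrC cosD2pi sinD2pi cosN sinN xE yE ltr0_norm// opprK//.
Qed.

Lemma circle_of_realK_itv t : 0 <= t < 1 -> arg (circle_of_real t) = t.
Proof.
move=> t01; rewrite /arg /circle_of_real /circle_coord /=.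
have pi0 := pi_gt0 R.
have [th|th] := leP t (1/2).
  have tpi : 0 <= 2 * pi * t <= pi by nra.
  by rewrite sin_ge0_pi// cosK ?in_itv//= [2 * pi * t]mulrC mulfK.
have e : 2 * pi * t = - (2 * pi * (1 - t)) + pi *+ 2.
  by rewrite -[pi *+ 2]mulr_natl; ring.
rewrite e cosD2pi sinD2pi cosN sinN oppr_ge0.
have tpi : 0 < 2 * pi * (1 - t) < pi by nra.
rewrite leNgt sin_gt0_pi//= cosK ?in_itv/=; last by lra.
by rewrite [2 * pi * _]mulrC mulfK// subKr.
Qed.

Lemma circle_of_realDz t (m : int) :
  circle_of_real (t + m%:~R) = circle_of_real t :> circle R.
Proof.
have D (n : nat) s : circle_of_real (s + n%:R) = circle_of_real s :> circle R.
  elim: n => [|n IH]; first by rewrite addr0.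
  by rewrite -natr1 addrA circle_of_realD1.
case: m => n; first exact: D.
by rewrite NegzE mulrNz -(D n.+1 (t - _)) subrK.
Qed.

Lemma circle_of_realK t : arg (circle_of_real t) = t - (Num.floor t)%:~R.
Proof.
rewrite -(circle_of_realDz t (- Num.floor t)) mulrNz circle_of_realK_itv//.
by have := floor_itv t; rewrite intrD; lra.
Qed.

Lemma circle_of_real_eq (s t : R) : circle_of_real s = circle_of_real t ->
  exists m : int, s = t + m%:~R.
Proof.
move=> /(congr1 arg); rewrite !circle_of_realK => e.
exists (Num.floor s - Num.floor t); rewrite intrB; lra.
Qed.

Lemma arg_inj : injective arg. Proof. exact: can_inj argK. Qed.

Lemma rotate_circle_of_real (theta t : R) :
  rotate theta (circle_of_real t) = circle_of_real (t + theta).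
Proof. by apply/val_inj; rewrite /= -cexpiD -mulrDr addrC. Qed.

Lemma measurable_arg : measurable_fun setT (arg : circle R -> measurableTypeR R).
Proof.
have mc := @measurable_circle_coord R.
have mx : measurable_fun setT (fun z : circle R => (circle_coord z).1).
  exact: measurableT_comp mc.
have my : measurable_fun setT (fun z : circle R => (circle_coord z).2).
  exact: measurableT_comp mc.
have ma : measurable_fun setT (fun z : circle R => acos (circle_coord z).1).
  apply: (@measurable_comp _ _ _ _ _ _ `[(-1 : R), 1]%classic (@acos R)) mx => //.
    move=> _ [z _ <-]; have := circle_coord_sqr z.
    by case: circle_coord => x y /= xy; rewrite in_itv /=; nra.
  apply: subspace_continuous_measurable_fun => //.
  have := @segment_can_ge_continuous R 0 pi cos acos (pi_ge0 R).
  rewrite cos0 cospi; apply => //.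
    exact/continuous_subspaceT/continuous_cos.
  exact: cosK.
rewrite (_ : arg = fun z => if 0 <= (circle_coord z).2
    then acos (circle_coord z).1 / (2 * pi)
    else 1 - acos (circle_coord z).1 / (2 * pi)); last first.
  by apply/funext => z; rewrite /arg; case: circle_coord.
apply: measurable_fun_ifT.
- exact: measurable_fun_ler.
- exact: measurable_funM.
- by apply: measurable_funB => //; exact: measurable_funM.
Qed.

End CircleArgument.

(** * Orbit equivalence and integrability criteria *)

Section DiscreteFunctions.
Context d (X : measurableType d).

(** Measurability for the discrete sigma-algebra on [T]; it survives composition with an arbitrary
    function. *)
Definition discrete_measurable (T : Type) (f : X -> T) :=
  forall B : set T, measurable (f @^-1` B).

Lemma discrete_measurableP (T : countType) (f : X -> T) :
  (forall j, measurable (f @^-1` [set j])) -> discrete_measurable f.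
Proof.
move=> mf B.
rewrite (_ : f @^-1` B = \bigcup_(j in B) (f @^-1` [set j])); last first.
  apply/seteqP; split => [x Bx|x [j Bj /= fx]]; first by exists (f x).
  by rewrite /preimage /= fx.
rewrite bigcup_mkcond; apply: countable_bigcupT_measurable.
  exact: countableP.
by move=> j; case: ifP.
Qed.

Lemma discrete_measurable_comp (T U : Type) (g : T -> U) (f : X -> T) :
  discrete_measurable f -> discrete_measurable (g \o f).
Proof. by move=> mf B; exact: (mf (g @^-1` B)). Qed.

Lemma discrete_measurable_fun d' (Y : measurableType d') (f : X -> Y) :
  discrete_measurable f -> measurable_fun setT f.
Proof. by move=> mf _ B _; rewrite setTI. Qed.

End DiscreteFunctions.

(** * Uniform laws from a cyclic factor *)

Section Equidistribution.
Context (R : realType) d (X : measurableType d) (mu : probability X R).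
Variables (T : aut mu) (f : X -> int) (b : int).
Hypotheses (b0 : 0 < b) (mf : discrete_measurable f).
Hypotheses (f_range : forall x, 0 <= f x < b)
  (fT : forall x, f (T x) = ((f x + 1) %% b)%Z).

(** [T] permutes the [b] level sets of [f] cyclically; they partition the space and have equal
    measure. *)
Lemma equidistributed j : 0 <= j < b -> mu (f @^-1` [set j]) = (b%:~R^-1)%:E.
Proof.
have E (n : nat) : n%:Z < b -> mu (f @^-1` [set n%:Z]) = mu (f @^-1` [set 0]).
  elim: n => // n IH nb; rewrite -IH; last by lia.
  rewrite -(mpfun_pushforward T)//; congr (mu _); apply/seteqP.
  split=> x /=; rewrite fT; last by move=> ->; rewrite modz_small; lia.
  move=> e.
  have [fb|fb] := ltP (f x + 1) b.
    by move: e; rewrite modz_small; have := f_range x; lia.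
  have : f x + 1 = b by have := f_range x; lia.
  by move=> fb1; rewrite fb1 modzz in e; lia.
have bE : b = `|b|%N%:Z by lia.
have : mu setT = (\sum_(i < `|b|%N) mu (f @^-1` [set i%:Z]))%E.
  rewrite -measure_bigsetU_ord//; last first.
  - apply/trivIsetP => i j' _ _ ij; apply/seteqP; split => // x [/= ->] [] ij'.
    by move/eqP: ij; apply; exact/val_inj.
  congr (mu _); apply/seteqP; split => // x _.
  rewrite -(@bigcup_mkord _ _ (fun i : nat => f @^-1` [set i%:Z])).
  by exists `|f x|%N; rewrite /preimage /=; have := f_range x; lia.
rewrite (eq_bigr (fun _ => mu (f @^-1` [set 0]))); last first.
  by move=> i _; apply: E; have := ltn_ord i; lia.
rewrite probability_setT => s.
case: j => // n /E ->; move: s.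
have fin : mu (f @^-1` [set 0]) \is a fin_num by exact: fin_num_measure.
rewrite -(fineK fin) sumEFin => -[].
rewrite sumr_const card_ord -mulr_natl => s.
congr EFin; rewrite {1}bE; apply: (mulfI (x := (`|b|%N)%:R)).
  by rewrite pnatr_eq0; lia.
by rewrite -s divff// pnatr_eq0; lia.
Qed.

Lemma equidistributed_le j : (mu (f @^-1` [set j]) <= (b%:~R^-1)%:E)%E.
Proof.
have [jb|jb] := boolP (0 <= j < b); first by rewrite equidistributed.
rewrite (_ : f @^-1` [set j] = set0).
  by rewrite measure0 lee_fin invr_ge0 ler0z ltW.
by apply/seteqP; split => // x /= fj; move: jb; rewrite -fj f_range.
Qed.

Lemma equidistributed_itv (m n : int) : m <= n ->
  (mu [set x | (m <= f x < n)%R] <= ((n - m)%:~R / b%:~R)%:E)%E.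
Proof.
rewrite -subr_ge0; move e : (n - m) => c; case: c e => // c e _.
have -> : n = m + c%:Z by lia.
elim: c {e} => [|c IH].
  rewrite (_ : [set _ | _] = set0) ?measure0 ?mul0r//.
  by apply/seteqP; split => // x /=; lia.
have -> : [set x | m <= f x < m + c.+1%:Z] =
    [set x | m <= f x < m + c%:Z] `|` f @^-1` [set m + c%:Z].
  apply/seteqP; split => x /=; last by case; lia.
  by move=> h; have [fx|fx] := eqVneq (f x) (m + c%:Z); [right|left; lia].
apply: (le_trans (measureU2 _ _ _)) => //.
  exact: (mf [set a | m <= a < m + c%:Z]).
apply: (le_trans (leeD IH (equidistributed_le _))).
rewrite -EFinD lee_fin (_ : (c.+1%:Z)%:~R = c%:Z%:~R + 1 :> R).
  by rewrite mulrDl mul1r.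
exact: mulrSr.
Qed.

End Equidistribution.

Lemma ae_mpiso (R : realType) d d' (X : measurableType d) (Y : measurableType d')
    (mu : probability X R) (nu : probability Y R) (f : mpiso mu nu)
    (P : Y -> Prop) :
  {ae nu, forall y, P y} -> {ae mu, forall x, P (f x)}.
Proof.
move=> [N [mN N0 PN]]; exists (f @^-1` N); split; last by move=> x /= /PN.
  by rewrite -[X in measurable X]setTI; exact: measurable_mpfun.
by rewrite -N0 -(mpfun_pushforward f).
Qed.

Section AutIter.
Context (R : realType) d (X : measurableType d) (mu : probability X R).
Implicit Types S T : aut mu.

Lemma aut_iterS S (k : int) x : aut_iter S (k + 1) x = S (aut_iter S k x).
Proof.
case: k => [n|[|n]]; first by rewrite -PoszD addn1.
  by rewrite /= mpinvK.
rewrite (_ : Negz n.+1 + 1 = Negz n); last by rewrite !NegzE; lia.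
by rewrite /= mpinvK.
Qed.

Lemma aut_iterD S (j k : int) x :
  aut_iter S (j + k) x = aut_iter S j (aut_iter S k x).
Proof.
elim: j => [|n IH|n IH]; first by rewrite add0r.
  by rewrite -addn1 PoszD addrAC aut_iterS IH -aut_iterS.
apply: (can_inj (mpfunK S)); rewrite -!aut_iterS.
rewrite (_ : - n.+1%:Z + k + 1 = - n%:Z + k); last by lia.
by rewrite (_ : - n.+1%:Z + 1 = - n%:Z)//; lia.
Qed.

Lemma ae_aut_iter S (P : X -> Prop) : {ae mu, forall x, P x} ->
  {ae mu, forall x, forall k, P (aut_iter S k x)}.
Proof.
move=> aeP.
have it (T : aut mu) n : {ae mu, forall x, P (iter n T x)}.
  elim: n => // n /(ae_mpiso T); apply: filterS => x.
  by rewrite iterSr.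
have := ae_foralln (it S); have := ae_foralln (fun n => it (mpsym S) n.+1).
by apply: filterS2 => x Sn Sp [n|n]; [exact: Sp|exact: Sn].
Qed.

(** The hypothesis holds almost surely along the whole orbit of [S], so it can be iterated in both
    directions. *)
Lemma sub_orbit S T : {ae mu, forall x, exists k, S x = aut_iter T k x} ->
  {ae mu, forall x, orbit_of S x `<=` orbit_of T x}.
Proof.
move=> /(ae_aut_iter S); apply: filterS => x ST _ [j _ <-].
elim: j => [|n [k _ IH]|n [k _ IH]]; first by exists 0.
  have [i Si] := ST n%:Z; exists (i + k) => //.
  by rewrite -addn1 PoszD aut_iterS Si aut_iterD IH.
(* Backwards, the exponent given at the new point is inverted. *)
have [i Si] := ST (- n.+1%:Z); exists (- i + k) => //.
rewrite aut_iterD IH (_ : - n%:Z = - n.+1%:Z + 1); last by lia.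
by rewrite aut_iterS Si -aut_iterD addNr.
Qed.

End AutIter.

Section OrbitEquivalenceCriteria.
Context (R : realType) d d' (X : measurableType d) (Y : measurableType d').
Context (mu : probability X R) (nu : probability Y R).
Variables (S : aut mu) (T : aut nu) (Psi : mpiso mu nu).

Lemma aut_iter_mpconj (k : int) x :
  aut_iter (mpconj Psi T) k x = mpinv Psi (aut_iter T k (Psi x)).
Proof.
elim: k x => [|n IH|n IH] x; first by rewrite /= mpfunK.
  by rewrite -addn1 PoszD !aut_iterS IH /= mpinvK.
have nE : - n.+1%:Z + 1 = - n%:Z by lia.
have := aut_iterS (mpconj Psi T) (- n.+1%:Z) x; rewrite nE IH.
set y := aut_iter (mpconj Psi T) (- n.+1%:Z) x.
rewrite -[mpconj Psi T y]/(mpinv Psi (T (Psi y))) => /(can_inj (mpinvK Psi)) e.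
apply: (can_inj (mpfunK Psi)).
by rewrite mpinvK; apply: (can_inj (mpfunK T)); rewrite -e -aut_iterS nE.
Qed.

Lemma orbit_equivalenceP :
  {ae mu, forall x, exists k, S x = mpinv Psi (aut_iter T k (Psi x))} ->
  {ae mu, forall x, exists k, mpinv Psi (T (Psi x)) = aut_iter S k x} ->
  orbit_equivalence S T Psi.
Proof.
move=> ST TS.
have /sub_orbit ST' : {ae mu, forall x, exists k, S x = aut_iter (mpconj Psi T) k x}.
  by apply: filterS ST => x [k ->]; exists k; rewrite aut_iter_mpconj.
have /sub_orbit TS' : {ae mu, forall x, exists k, mpconj Psi T x = aut_iter S k x}.
  by apply: filterS TS => x [k e]; exists k.
by apply: filterS2 ST' TS' => x s1 s2; rewrite eqEsubset.
Qed.

(** Freeness of [T] makes the exponent unique where it exists, so the level sets of [c] are the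
    measurable sets of the last hypothesis, up to the default value. *)
Lemma cocycle_exists :
  (forall y j k, aut_iter T j y = aut_iter T k y -> j = k) ->
  {ae mu, forall x, exists k, S x = mpinv Psi (aut_iter T k (Psi x))} ->
  (forall k, measurable [set x | S x = mpinv Psi (aut_iter T k (Psi x))]) ->
  exists2 c : X -> int, is_cocycle S T Psi c &
    forall x k, S x = mpinv Psi (aut_iter T k (Psi x)) -> c x = k.
Proof.
move=> free ae_ex mF; pose F k x := S x = mpinv Psi (aut_iter T k (Psi x)).
have F_inj x j k : F j x -> F k x -> j = k.
  by rewrite /F => -> /(can_inj (mpinvK Psi)) /free.
pose c x : int := xget 0 [set k | F k x].
have cE x k : F k x -> c x = k.
  by move=> Fk; apply: (@F_inj x); rewrite // /c; exact: (@xgetI _ 0 [set k | F k x] k).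
exists c => //; split; last first.
  by apply: filterS ae_ex => x [k Fk]; rewrite (cE _ _ Fk).
(* 0 is the default of [xget]: its level set also contains the points without exponent. *)
move=> k; have [->|k0] := eqVneq k 0; last first.
  rewrite (_ : c @^-1` [set k] = F k); first exact: mF.
  apply/seteqP; split => [x /= cx|x /cE//].
  have [[j Fj]|nF] := pselect (exists j, F j x).
    by rewrite -cx (cE _ _ Fj).
  case/eqP: k0; rewrite -cx /c xgetPN// => j Fj; apply: nF; by exists j.
rewrite (_ : c @^-1` [set 0] = F 0 `|` ~` (\bigcup_k F k)); last first.
  apply/seteqP; split => [x /= cx|x [/cE//|nF]] /=; last first.
    by rewrite /c xgetPN// => j Fj; apply: nF; exists j.
  have [[j _ Fj]|nF] := pselect ((\bigcup_k F k) x); last by right.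
  by left; rewrite -cx (cE _ _ Fj).
apply: measurableU; first exact: mF.
by apply: measurableC; apply: countable_bigcupT_measurable.
Qed.

End OrbitEquivalenceCriteria.

(** * Integrability from bad sets of small measure *)

Section IntegralBound.
Context (R : realType) d (X : measurableType d) (mu : probability X R).
Variable B : nat -> set X.
Hypothesis mB : forall n, measurable (B n).

(** Borel-Cantelli: the exceptional set is the limit superior. *)
Lemma ae_eventually_notin :
  (forall n, (mu (B n) <= (1 / (2 ^ n.+1)%:R)%:E)%E) ->
  {ae mu, forall x, exists n, forall N, (n <= N)%N -> ~ B N x}.
Proof.
move=> muB; exists (lim_sup_set B); split.
- apply: bigcapT_measurable => n; exact: bigcup_measurable.
- apply: lim_sup_set_cvg0 => //.
  apply: le_lt_trans (ltry 1); apply: le_trans (epsilon_trick0 xpredT ler01).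
  by apply: lee_nneseries => // n _; exact: muB.
- move=> x /= nx n _; apply: contrapT => h.
  by case: nx; exists n => N nN BN; apply: h; exists N.
Qed.

Variables (phi : R -> R) (phi_ge0 : forall t, 0 <= t -> 0 <= phi t).
Variables (c : X -> int) (mc : discrete_measurable c).
Variables (L : nat -> nat) (w : nat -> R).
Hypothesis phi_w : forall n j, (j <= L n)%N -> phi j%:R <= w n.
Hypothesis w_ge1 : forall n, 1 <= w n.+1.
Hypothesis muB : forall n, ((w n.+1)%:E * mu (B n) <= (1 / (2 ^ n.+1)%:R)%:E)%E.
Hypothesis c_le : {ae mu, forall x, forall n,
  (forall N, (n <= N)%N -> ~ B N x) -> (`|c x| <= L n)%N}.

(** If [m] is the first index from which [x] avoids all [B N], then [m] is 0 or [x] lies in [B] at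
    index [m - 1]. Hence the integrand is at most [w 0] plus the sum of the [w n.+1] over the [n]
    with [x] in [B n], whose integral is bounded by a geometric series. *)
Lemma integral_lty : (\int[mu]_x (phi `|c x|%N%:R)%:E < +oo)%E.
Proof.
have w_ge0 n : 0 <= w n.
  by apply: le_trans (phi_w (leq0n _)); rewrite phi_ge0.
have muB' n : (mu (B n) <= (1 / (2 ^ n.+1)%:R)%:E)%E.
  by apply: le_trans (muB n); rewrite -{1}[mu _]mul1e lee_wpmul2r// lee_fin.
pose G n x : \bar R := ((w n.+1)%:E * (\1_(B n) x)%:E)%E.
have G0 n x : (0 <= G n x)%E by rewrite mule_ge0// lee_fin.
have mG n : measurable_fun setT (G n).
  by apply: measurable_funeM; apply/measurable_EFinP; exact: measurable_indic.
have mGs : measurable_fun setT (fun x => \sum_(n <oo) G n x)%E.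
  exact: ge0_emeasurable_sum.
apply: (@le_lt_trans _ _ (\int[mu]_x ((w 0)%:E + \sum_(n <oo) G n x))%E).
  apply: ae_ge0_le_integral => //.
  - by move=> x _; rewrite lee_fin phi_ge0.
  - apply/measurable_EFinP; apply: discrete_measurable_fun.
    exact: (discrete_measurable_comp (fun k : int => phi `|k|%N%:R)).
  - by move=> x _; rewrite adde_ge0 ?lee_fin// nneseries_ge0.
  - exact: emeasurable_funD.
  apply: filterS2 c_le (ae_eventually_notin muB') => x cx [n nB] _.
  have [m [Bm nm]] : exists m, (if m is k.+1 then B k x else True) /\
      (forall N, (m <= N)%N -> ~ B N x).
    elim: n nB => [nB|n IH nB]; first by exists 0%N.
    have [Bn|nBn] := pselect (B n x); first by exists n.+1.
    apply: IH => N; rewrite leq_eqVlt => /predU1P[<-//|]; exact: nB.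
  apply: (@le_trans _ _ (w m)%:E); first by rewrite lee_fin phi_w// cx.
  case: m Bm {nm} => [_|m Bm].
    by rewrite leeDl// nneseries_ge0.
  apply: (@le_trans _ _ (\sum_(n <oo) G n x)%E); last first.
    by rewrite leeDr// lee_fin.
  apply: le_trans (nneseries_lim_ge m.+1 (fun n _ _ => G0 n x)).
  rewrite big_nat_recr//= {2}/G indicE mem_set//= mule1 leeDr//.
  exact: sume_ge0.
rewrite ge0_integralD//; last 2 first.
- by move=> x _; rewrite lee_fin.
- by move=> x _; exact: nneseries_ge0.
rewrite integral_cst// [X in (_ * X + _)%E](probability_setT mu) mule1.
rewrite integral_nneseries//.
apply: lte_add_pinfty; first exact: ltry.
apply: le_lt_trans (ltry 1); apply: le_trans (epsilon_trick0 xpredT ler01).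
apply: lee_nneseries => n _; first by rewrite integral_ge0.
rewrite ge0_integralZl//; last 2 first.
- by apply/measurable_EFinP; exact: measurable_indic.
- by rewrite lee_fin.
by rewrite integral_indic// setIT.
Qed.

End IntegralBound.

(** * Modification on a countable set *)

Lemma measurable_fun_patch d1 d2 (X1 : measurableType d1) (X2 : measurableType d2)
    (A : set X1) (f g : X1 -> X2) :
  (forall x : X1, measurable [set x]) -> countable A ->
  measurable_fun setT g -> (forall x, ~ A x -> f x = g x) ->
  measurable_fun setT f.
Proof.
move=> m1 cA mg fg _ B mB; rewrite setTI.
have mA C : C `<=` A -> measurable C.
  move=> CA; apply: countable_measurable => //.
  exact: sub_countable (subset_card_le CA) cA.
rewrite (_ : f @^-1` B = (f @^-1` B `&` A) `|` (g @^-1` B `&` ~` A)).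
  apply: measurableU; first by apply: mA => x [].
  apply: measurableI; last by apply: measurableC; exact: mA.
  by rewrite -[X in measurable X]setTI; exact: mg.
apply/seteqP; split => x /=; last by case=> -[]// + nAx; rewrite fg.
have [Ax|nAx] := pselect (A x); first by left.
by move=> Bf; right; split => //; rewrite -fg.
Qed.

Section Patching.
Context (R : realType) d d' (X : measurableType d) (Y : measurableType d').
Context (mu : probability X R) (nu : probability Y R).

(* Hilbert's hotel: a sequence of points of X makes room for the points of Y
   missed by psi. *)
Lemma mpiso_patch (psi : X -> Y) (Phi : Y -> X) (e : nat -> X) :
  (forall x : X, measurable [set x]) -> (forall y : Y, measurable [set y]) ->
  (forall x : X, mu [set x] = 0%E) ->
  measurable_fun setT psi -> measurable_fun setT Phi ->
  cancel psi Phi -> countable (~` range psi) -> injective e ->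
  (forall A, measurable A -> mu (psi @^-1` A) = nu A) ->
  exists Psi : mpiso mu nu, forall x, ~ range e x -> Psi x = psi x.
Proof.
move=> m1 m2 mu1 mpsi mPhi psiK cD e_inj push.
pose E := range e; pose B := psi @` E `|` ~` range psi.
have cE : countable E.
  by apply: sub_countable (countableP [set: nat]); exact: card_image_le.
have cB : countable B.
  have -> : B = \bigcup_(b in [set: bool]) (if b then psi @` E else ~` range psi).
    apply/seteqP; split => [y [Ey|Dy]|y [[] _ ?]]; [|by exists false|by left|by right].
    by exists true.
  apply: bigcup_countable => // -[] _ //.
  by apply: sub_countable cE; exact: card_image_le.
have iE : infinite_set E.
  apply/infiniteP; rewrite (card_le_eqr (inj_card_eq _)) ?card_lexx//.
  exact: in2W.
have iB : infinite_set B.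
  apply: (@sub_infinite_set _ (psi @` E)); first by move=> y; left.
  apply/infiniteP; rewrite (card_le_eqr (inj_card_eq _)); first exact/infiniteP.
  by apply: in2W; exact: can_inj psiK.
(* Both sets are countably infinite. A bijection between them replaces [psi] on the sequence and
   also reaches the missed points. *)
have /ppcard_eqP[f] : (E #= B)%card.
  by apply: card_eq_trans (eq_card_nat cE iE) (card_esym (eq_card_nat cB iB)).
pose F x := if x \in E then f x else psi x.
pose G y := if y \in B then (f^-1)%FUN y else Phi y.
have nB x : ~ E x -> ~ B (psi x).
  move=> nE [[x' Ex' /(can_inj psiK)xx']|[]]; last by exists x.
  by apply: nE; rewrite -xx'.
have nB' y : ~ B y -> psi (Phi y) = y /\ ~ E (Phi y).
  move=> nBy; have [x _ yE] : range psi y by apply: contrapT => ?; apply: nBy; right.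
  by rewrite -yE psiK; split => // Ex; apply: nBy; left; rewrite -yE; exists x.
have FK : cancel F G.
  move=> x; rewrite /F; case: ifPn => [Ex|/negP Ex].
    by rewrite /G mem_set ?funK//; apply: funS; exact: set_mem.
  rewrite /G memNset ?psiK//; apply: nB => ?; apply: Ex; exact: mem_set.
have GK : cancel G F.
  move=> y; rewrite /G; case: ifPn => [By|/negP By].
    by rewrite /F mem_set ?invK//; apply: invS; exact: set_mem.
  have [|e1 e2] := nB' y; first by move=> ?; apply: By; exact: mem_set.
  by rewrite /F memNset.
have Fpsi x : ~ E x -> F x = psi x by move=> nE; rewrite /F memNset.
have mF : measurable_fun setT F by exact: (measurable_fun_patch m1 cE mpsi).
have mG : measurable_fun setT G.
  apply: (measurable_fun_patch m2 cB mPhi) => y nBy.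
  by rewrite /G memNset.
have muE : mu E = 0%E.
  have mE : measurable E by exact: countable_measurable.
  apply/(negligibleP _ mE); rewrite (_ : E = \bigcup_n [set e n]).
    by apply: negligible_bigcup => n; apply/(negligibleP _ (m1 _)); exact: mu1.
  by apply/seteqP; split => [_ [n _ <-]|_ [n _ ->]]; exists n.
have pF A : measurable A -> pushforward mu F A = nu A.
  move=> mA; rewrite -push// /pushforward.
  have mE : measurable E by exact: countable_measurable.
  have mFA : measurable (F @^-1` A) by rewrite -[X in measurable X]setTI; exact: mF.
  have mpA : measurable (psi @^-1` A).
    by rewrite -[X in measurable X]setTI; exact: mpsi.
  (* The modification takes place inside the null set [E]. *)
  have mudE C : measurable C -> mu C = mu (C `\` E).
    move=> mC; rewrite (measureDI mu mC mE) [X in (_ + X)%E](_ : _ = 0%E) ?adde0//.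
    by apply: (subset_measure0 _ _ _ muE) => //; exact: measurableI.
  rewrite (mudE _ mFA) (mudE _ mpA); congr (mu _).
  by apply/seteqP; split => x [/= Ax nE]; split => //=; move: Ax; rewrite Fpsi.
by exists (MPIso FK GK mF mG pF) => x /=; exact: Fpsi.
Qed.

End Patching.

(** * Residues on the odometer *)

Section OdometerResidues.
Variables (q : nat -> nat) (q_ge2 : forall n, (2 <= q n)%N).
Local Notation Y := (odo_space q_ge2).
Implicit Types (x y : Y) (m n : nat) (b : int).

Definition radix_prod m : nat := (\prod_(k < m) q k)%N.
Local Notation P := radix_prod.

Lemma radix_prodS m : P m.+1 = (P m * q m)%N.
Proof. by rewrite /P big_ord_recr. Qed.

Lemma radix_prod_gt0 m : (0 < P m)%N.
Proof. by rewrite prodn_gt0// => k; exact: ltnW (q_ge2 k). Qed.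

Lemma dvdn_radix_prod m n : (m <= n)%N -> (P m %| P n)%N.
Proof.
move=> /subnK <-; elim: (n - m)%N => // k IH; apply: (dvdn_trans IH).
by rewrite addSn radix_prodS dvdn_mulr.
Qed.

Definition low_value y m : nat := (\sum_(k < m) y k * P k)%N.

Lemma low_valueS y m : low_value y m.+1 = (low_value y m + y m * P m)%N.
Proof. by rewrite /low_value big_ord_recr. Qed.

Lemma low_value_lt y m : (low_value y m < P m)%N.
Proof.
elim: m => [|m IH]; first by rewrite /low_value /P !big_ord0.
by rewrite low_valueS radix_prodS; have := ltn_ord (y m); nia.
Qed.

Lemma low_value_mod y m n : (m <= n)%N -> (low_value y n %% P m)%N = low_value y m.
Proof.
move=> /subnK <-; elim: (n - m)%N => [|k IH].
  by rewrite modn_small// low_value_lt.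
have /dvdnP[c E] : (P m %| P (k + m))%N by rewrite dvdn_radix_prod// leq_addl.
by rewrite addSn low_valueS E mulnA addnC modnMDl.
Qed.

Lemma low_value_succ y m :
  (low_value (odo_succ y) m + carry y m * P m)%N = (low_value y m).+1.
Proof.
elim: m => [|m IH]; first by rewrite /low_value /P !big_ord0.
rewrite !low_valueS radix_prodS -addSn -IH /=.
by have := divn_eq (y m + carry y m) (q m); nia.
Qed.

Lemma low_value_odo_succ y m :
  low_value (odo_succ y) m = ((low_value y m).+1 %% P m)%N.
Proof. by rewrite -low_value_succ addnC modnMDl modn_small// low_value_lt. Qed.

Lemma low_value_agree m x y : agree m x y -> low_value x m = low_value y m.
Proof. by move=> xy; apply: eq_bigr => k _; rewrite xy. Qed.

Lemma low_value_inj x y : (forall m, low_value x m = low_value y m) -> x = y.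
Proof.
move=> xy; apply: functional_extensionality_dep => n; apply/val_inj => /=.
have := xy n.+1; rewrite !low_valueS xy => /addnI /eqP.
by rewrite eqn_pmul2r ?radix_prod_gt0// => /eqP.
Qed.

(** The odometer is the inverse limit of the residues modulo the [P m]: a coherent sequence yields
    digits as quotients. *)
Lemma low_value_digits (w : nat -> nat) :
  (forall m, (w m.+1 %% P m)%N = w m) -> w 0 = 0 ->
  forall m, low_value (fun n => digit q_ge2 n (w n.+1 %/ P n)) m = w m.
Proof.
move=> wS w0; elim=> [|m IH]; first by rewrite /low_value big_ord0.
rewrite low_valueS IH /= modn_small; last first.
  by rewrite ltn_divLR ?radix_prod_gt0// mulnC -radix_prodS -wS ltn_pmod ?radix_prod_gt0.
by rewrite addnC -(wS m) -divn_eq.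
Qed.

Lemma measurable_low_value m : discrete_measurable (low_value ^~ m : Y -> nat).
Proof.
move=> B; rewrite measurable_odo_spaceE; apply: (determined_cylinders (n := m)).
by move=> x y /low_value_agree; rewrite /preimage /= => ->.
Qed.

Section Residue.
Hypothesis q_univ : universal q.

(** Each prime factor of [b] reaches its multiplicity at some level by universality; there are
    finitely many, so one level serves all. *)
Lemma dvd_radix_prod b : 0 < b -> exists m, (b %| (P m)%:Z)%Z.
Proof.
case: b => // b b0.
have [M hM] : exists M, forall p, p \in primes b -> (logn p b <= logn p (P M))%N.
  have logP p M : logn p (P M) = (\sum_(k < M) logn p (q k))%N.
    elim: M => [|M IH]; first by rewrite /P !big_ord0 logn1.
    rewrite radix_prodS lognM ?radix_prod_gt0 ?IH ?big_ord_recr//.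
    exact: ltnW (q_ge2 M).
  have : all prime (primes b).
    by apply/allP => p; rewrite mem_primes => /and3P[].
  elim: (primes b) => [_|p s IH /= /andP[pp /IH[M hM]]]; first by exists 0%N.
  have [M' hM'] := q_univ pp (logn p b); exists (maxn M M') => r.
  rewrite inE => /predU1P[->|rs].
    apply: (leq_trans hM'); rewrite -logP dvdn_leq_log ?radix_prod_gt0//.
    by rewrite dvdn_radix_prod// leq_maxr.
  apply: (leq_trans (hM _ rs)); rewrite dvdn_leq_log ?radix_prod_gt0//.
  by rewrite dvdn_radix_prod// leq_maxl.
exists M; rewrite dvdzE /=; apply/dvdn_partP => // p pb.
have /and3P[pp _ _] : [&& prime p, (0 < b)%N & (p %| b)%N] by rewrite -mem_primes.
by rewrite p_part pfactor_dvdn ?radix_prod_gt0// hM.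
Qed.

(** A level from which reduction modulo [b] is well defined on digits; by [residueE] any other such
    level gives the same residue. *)
Definition residue_level b : nat := xget 0%N [set m | (b %| (P m)%:Z)%Z].
Local Notation lev := residue_level.

Lemma residue_levelP b : 0 < b -> (b %| (P (lev b))%:Z)%Z.
Proof.
move=> /dvd_radix_prod[m bm].
exact: (@xgetI _ 0%N [set m | (b %| (P m)%:Z)%Z] m).
Qed.

Definition residue b y : int := ((low_value y (lev b))%:Z %% b)%Z.

Lemma residue_range b y : 0 < b -> 0 <= residue b y < b.
Proof. exact: modz_range. Qed.

Lemma residueE b y m : 0 < b -> (b %| (P m)%:Z)%Z ->
  residue b y = ((low_value y m)%:Z %% b)%Z.
Proof.
move=> b0 bm; have bl := residue_levelP b0; rewrite /residue.
have E n : (b %| (P n)%:Z)%Z -> (n <= maxn m (lev b))%N ->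
    ((low_value y n)%:Z %% b)%Z = ((low_value y (maxn m (lev b)))%:Z %% b)%Z.
  by move=> bn nm; rewrite -(low_value_mod y nm) -modz_nat modz_dvd.
by rewrite !E ?leq_maxl ?leq_maxr.
Qed.

Lemma residue_succ b y : 0 < b -> residue b (odo_succ y) = ((residue b y + 1) %% b)%Z.
Proof.
move=> b0; have bl := residue_levelP b0.
by rewrite /residue low_value_odo_succ -modz_nat modz_dvd// modzDml -addn1 PoszD.
Qed.

Lemma residue_dvd a b y : 0 < a -> 0 < b -> (a %| b)%Z ->
  (residue b y %% a)%Z = residue a y.
Proof.
move=> a0 b0 ab; rewrite [residue b y]/residue modz_dvd//.
by rewrite (residueE y a0 (dvdz_trans ab (residue_levelP b0))).
Qed.

Lemma residue_radix y m : residue (P m)%:Z y = (low_value y m)%:Z.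
Proof.
by rewrite (@residueE _ _ m) ?modz_nat ?modn_small ?low_value_lt// ltz_nat radix_prod_gt0.
Qed.

Lemma measurable_residue b : discrete_measurable (residue b : Y -> int).
Proof.
exact: (discrete_measurable_comp (fun n : nat => (n%:Z %% b)%Z)
          (measurable_low_value (lev b))).
Qed.

End Residue.

Variable R : realType.
Local Notation S := (odometer q_ge2 R).

Lemma residue_iter (q_univ : universal q) b (k : int) y : 0 < b ->
  residue b (aut_iter S k y) = ((residue b y + k) %% b)%Z.
Proof.
move=> b0; elim: k => [|n IH|n IH].
- by rewrite addr0 modz_small//; exact: residue_range.
- by rewrite -addn1 PoszD aut_iterS residue_succ// IH modzDml addrA.
have nE : - n.+1%:Z + 1 = - n%:Z by lia.
have := residue_succ q_univ (aut_iter S (- n.+1%:Z) y) b0.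
rewrite -[odo_succ _]/(S _) -aut_iterS nE IH.
have := residue_range (aut_iter S (- n.+1%:Z) y) b0.
move: (residue b _) => z zb zE.
rewrite -[LHS](modz_small zb); apply/eqP; rewrite -(eqz_modDr 1) -addrA nE.
exact/eqP.
Qed.

End OdometerResidues.

(** * The tower of arcs on the circle *)

Section CircleTowers.
Variables (R : realType) (W : tower).
Local Notation Q := (height W).
Local Notation k := (cuts W).
Local Notation p := (numer W).
Implicit Types z : circle R.

Lemma intr_height_gt0 N : 0 < (Q N)%:~R :> R.
Proof. by rewrite ltr0z height_gt0. Qed.
Hint Resolve intr_height_gt0 : core.

Lemma inv_height_small (e : R) : 0 < e -> exists N, (Q N)%:~R^-1 <= e.
Proof.
move=> e0; exists (Num.truncn e^-1).+1.
rewrite invf_ple ?posrE//; apply: le_trans (ltW (truncnS_gt _)) _.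
rewrite -[X in X <= _]/((Num.truncn e^-1).+1%:Z%:~R) ler_int.
exact/ltW/ltn_height.
Qed.

Lemma eq_of_close_height (a b : R) :
  (forall N, `|a - b| <= (Q N)%:~R^-1) -> a = b.
Proof.
move=> ab; apply/eqP; rewrite -subr_eq0 -normr_le0.
apply/ler_addgt0Pr => e /inv_height_small[N eN].
by rewrite add0r; exact: le_trans (ab N) eN.
Qed.

Lemma floor_divz (x : R) (m : int) : 0 < m ->
  (Num.floor (x * m%:~R) %/ m)%Z = Num.floor x.
Proof.
move=> m0; apply/esym/floor_def; have m0' : 0 < m%:~R :> R by rewrite ltr0z.
have := floor_itv (x * m%:~R); set a := Num.floor _ => /andP[ax xa].
have := modz_range a m0; rewrite (divz_eq a m) in ax xa.
set d := (a %/ m)%Z in ax xa *; set r := (a %% m)%Z in ax xa * => /andP[r0 rm].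
rewrite -(ler_pM2r m0') -(ltr_pM2r m0') -!intrM; apply/andP; split.
  by apply: le_trans ax; rewrite ler_int lerDl.
by apply: lt_le_trans xa _; rewrite ler_int; lia.
Qed.

Definition arc N z : int := Num.floor (arg z * (Q N)%:~R).

Lemma arc_range N z : 0 <= arc N z < Q N.
Proof.
have /andP[a0 a1] := arg_range z.
rewrite /arc floor_ge_int mulr_ge0 ?(ltW (intr_height_gt0 N))//=.
by rewrite floor_lt_int -[X in _ < X]mul1r ltr_pM2r.
Qed.

Lemma arcS_div N z : (arc N.+1 z %/ k N)%Z = arc N z.
Proof. by rewrite /arc heightSk intrM mulrA floor_divz// cuts_gt0. Qed.

Lemma measurable_arc N : discrete_measurable (arc N).
Proof.
apply: discrete_measurableP => j.
have ma : measurable_fun setT (fun z : circle R => arg z * (Q N)%:~R).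
  by apply: measurable_funM => //; exact: measurable_arg.
rewrite (_ : _ @^-1` _ = setT `&` (fun z : circle R => arg z * (Q N)%:~R) @^-1`
    `[j%:~R, (j + 1)%:~R[).
  exact: ma.
rewrite setTI; apply/seteqP; split => z; rewrite /preimage /= in_itv /=.
  by move=> <-; exact: floor_itv.
exact: floor_def.
Qed.

Definition circle_time N z : int := time_of_arc W N (arc N z).
Local Notation ct := circle_time.

Lemma circle_time_range N z : 0 <= ct N z < Q N.
Proof. exact: time_of_arc_range. Qed.

Lemma circle_timeP z : time_sequence W (ct ^~ z).
Proof.
move=> N; split; first exact: circle_time_range.
by rewrite lower_time_of_arc ?arc_range// arcS_div.
Qed.

Lemma circle_time_cuts N z : (ct N.+1 z %% k N)%Z = (arc N.+1 z %% k N)%Z.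
Proof. by rewrite lower_time_of_arc ?arc_range. Qed.

Lemma arc_circle_time N z : arc N z = ((p N * ct N z) %% Q N)%Z.
Proof. by rewrite time_of_arc_numer modz_small// arc_range. Qed.

Lemma measurable_circle_time N : discrete_measurable (ct N).
Proof. exact: (discrete_measurable_comp _ (measurable_arc N)). Qed.

Lemma arg_rotate (s : R) z : exists m : int, arg (rotate s z) = arg z + s + m%:~R.
Proof.
rewrite -{1}(argK z) rotate_circle_of_real circle_of_realK.
by exists (- Num.floor (arg z + s)); rewrite mulrNz.
Qed.

Definition approx N : R := (p N)%:~R / (Q N)%:~R.

(** Multiplication by the inverse of [p N] modulo [Q N] turns an arc increment [s * p N] into [s];
    [m] counts the turns. *)
Lemma circle_time_shift N z z' (s m : int) :
  arc N z' = arc N z + s * p N + m * Q N -> (ct N z' = ct N z + s %[mod Q N])%Z.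
Proof.
move=> E; rewrite /ct /time_of_arc E modz_mod modzDml.
apply/eqP; rewrite eqz_mod_dvd.
have /eqP := inv_numerP W N; rewrite eqz_mod_dvd => /dvdzP[c uE].
apply/dvdzP; exists (s * c + inv_numer W N * m).
by rewrite mulrDl -[s * c * _]mulrA -uE; ring.
Qed.

(** The rational rotation moves arcs onto arcs, by [p N] places. As it preserves the Haar measure,
    it gives the laws of the times through [equidistributed]. *)
Lemma circle_time_approx N z :
  ct N (rotate (approx N) z) = ((ct N z + 1) %% Q N)%Z.
Proof.
rewrite -[LHS](modz_small (circle_time_range _ _)).
have [m mE] := arg_rotate (approx N) z.
apply: (@circle_time_shift N z _ 1 m).
rewrite /arc mE !mulrDl /approx divfK ?gt_eqF// -addrA -intrM -intrD.
by rewrite floorDrz ?intr_int// intrKfloor mul1r addrA.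
Qed.

Lemma circle_time_law N j : 0 <= j < Q N ->
  circle_haar R (ct N @^-1` [set j]) = ((Q N)%:~R^-1)%:E.
Proof.
apply: (@equidistributed _ _ _ _ (rotation (approx N))).
- exact: height_gt0.
- exact: measurable_circle_time.
- exact: circle_time_range.
- exact: circle_time_approx.
Qed.

Lemma circle_time_law_le N j :
  (circle_haar R (ct N @^-1` [set j]) <= ((Q N)%:~R^-1)%:E)%E.
Proof.
apply: (@equidistributed_le _ _ _ _ (rotation (approx N))).
- exact: height_gt0.
- exact: measurable_circle_time.
- exact: circle_time_range.
- exact: circle_time_approx.
Qed.

Lemma circle_time_mod_law N (b m n : int) : 0 < b -> (b %| Q N)%Z -> m <= n ->
  (circle_haar R [set z | (m <= (ct N z %% b)%Z < n)%R]
     <= ((n - m)%:~R / b%:~R)%:E)%E.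
Proof.
move=> b0 bQ; apply: (@equidistributed_itv _ _ _ _ (rotation (approx N))) => //.
- exact: (discrete_measurable_comp (fun t => (t %% b)%Z) (@measurable_circle_time N)).
- by move=> z; exact: modz_range.
- by move=> z; rewrite /= circle_time_approx modz_dvd// modzDml.
Qed.

Lemma measurable_circle_set1 z : measurable [set z].
Proof.
rewrite (_ : [set z] = setT `&` @arg R @^-1` [set arg z]).
  by apply: measurable_arg => //; exact: measurable_set1.
by rewrite setTI; apply/seteqP; split => z' /=; [move=> ->|exact: arg_inj].
Qed.

Lemma circle_haar_set1 z : circle_haar R [set z] = 0%E.
Proof.
apply/eqP; rewrite eq_le measure_ge0 andbT; apply/lee_addgt0Pr => e e0.
rewrite add0e; have [N eN] := inv_height_small e0.
apply: (@le_trans _ _ (circle_haar R (ct N @^-1` [set ct N z]))).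
  apply: le_measure; rewrite ?inE; [exact: measurable_circle_set1| |].
    exact: measurable_circle_time.
  by move=> _ ->.
by apply: le_trans (circle_time_law_le _ _) _; rewrite lee_fin.
Qed.

Definition circle_value N z : int := value_of_time W N (ct N z).
Local Notation cv := circle_value.

Lemma circle_value_range N z : 0 <= cv N z < Q N.
Proof. exact/value_of_time_range/circle_time_range. Qed.

(** The values at the different levels are coherent under reduction, so they designate a point of
    the odometer. *)
Lemma circle_value_mod N M z : (N <= M)%N -> (cv M z %% Q N)%Z = cv N z.
Proof.
move=> /subnK <-; elim: (M - N)%N => [|m IH].
  by rewrite modz_small// circle_value_range.
rewrite -IH addSn -(modz_dvd _ (dvdz_height W (leq_addl m N))).
congr ((_ %% _)%Z); rewrite /cv value_of_timeS.
by have [_ ->] := circle_timeP z (m + N).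
Qed.

Lemma measurable_circle_value N : discrete_measurable (cv N).
Proof. exact: (discrete_measurable_comp _ (@measurable_circle_time N)). Qed.

Lemma circle_value_law N j : 0 <= j < Q N ->
  circle_haar R (cv N @^-1` [set j]) = ((Q N)%:~R^-1)%:E.
Proof.
move=> jQ; rewrite -(circle_time_law (time_of_value_range jQ)).
congr (circle_haar R _); apply/seteqP; split => z /=.
  by move=> <-; rewrite value_of_timeK// circle_time_range.
by rewrite /cv => ->; rewrite time_of_valueK.
Qed.

End CircleTowers.

(** * Identification of the circle with the odometer *)

Section CircleOdometer.
Variables (R : realType) (W : tower).
Variables (q : nat -> nat) (q_ge2 : forall n, (2 <= q n)%N).
Hypothesis q_univ : universal q.
Hypothesis radix_height : forall N, ((radix_prod q N)%:Z %| height W N.+1)%Z.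
Local Notation Q := (height W).
Local Notation k := (cuts W).
Local Notation p := (numer W).
Local Notation P := (radix_prod q).
Local Notation Y := (odo_space q_ge2).
Local Notation cv := (circle_value W).
Implicit Types (z : circle R) (y : Y).

Let Q0 N : 0 < Q N := height_gt0 W N.

(** Digit [n] depends on the value modulo [P n.+1], which divides [Q n.+2]; hence the level. *)
Definition odometer_of_circle z : Y :=
  fun n => digit q_ge2 n (`|cv n.+2 z|%N %% P n.+1 %/ P n).
Local Notation psi := odometer_of_circle.

Lemma residue_odometer_of_circle N z : residue (Q N) (psi z) = cv N z.
Proof.
pose w m : nat := (`|cv m.+1 z| %% P m)%N.
have wE m M : (m < M)%N -> (w m)%:Z = (cv M z %% (P m)%:Z)%Z.
  move=> mM; rewrite -[RHS](modz_dvd _ (radix_height m)) circle_value_mod//.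
  by rewrite /w -modz_nat gez0_abs//; have /andP[] := circle_value_range W m.+1 z.
have wS m : (w m.+1 %% P m)%N = w m.
  apply/eqP; rewrite -eqz_nat -modz_nat (wE m.+1 m.+2)// (wE m m.+2)//.
  by rewrite modz_dvd// dvdzE /= dvdn_radix_prod.
have w0 : w 0 = 0%N by rewrite /w /P big_ord0 modn1.
have vE m : low_value (psi z) m = w m by rewrite -(low_value_digits q_ge2 wS w0).
have lP := residue_levelP q_ge2 q_univ (Q0 N).
rewrite /residue vE; set m := residue_level q (Q N) in lP *.
(* [Q N] divides [P m]; both reductions are compared at a common deeper level. *)
rewrite (wE m (maxn m.+1 N)) ?leq_maxl// modz_dvd//.
by rewrite circle_value_mod// leq_maxr.
Qed.

Lemma measurable_odometer_of_circle : measurable_fun setT psi.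
Proof.
apply: (measurability (@coordinate_sets _ q_ge2)) => //.
move=> _ [A [n [B ->]] <-]; rewrite setTI.
exact: (@measurable_circle_value R W n.+2
  [set v | B (digit q_ge2 n (`|v|%N %% P n.+1 %/ P n))]).
Qed.

Lemma residue_height_inj y y' :
  (forall N, residue (Q N) y = residue (Q N) y') -> y = y'.
Proof.
move=> yy'; apply: low_value_inj => m; apply/eqP; rewrite -eqz_nat.
have P0 : 0 < (P m)%:Z by rewrite ltz_nat radix_prod_gt0.
rewrite -!(residue_radix q_univ) -!(residue_dvd q_univ _ P0 (Q0 m.+1))//.
by rewrite yy'.
Qed.

Lemma residue_law N j : 0 <= j < Q N ->
  odo_measure q_ge2 R (residue (Q N) @^-1` [set j]) = ((Q N)%:~R^-1)%:E.
Proof.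
apply: (@equidistributed _ _ _ _ (odometer q_ge2 R)) => //.
- exact: measurable_residue.
- by move=> y; exact: residue_range.
- by move=> y; exact: residue_succ.
Qed.

Lemma residue_preimage_law N (J : set int) :
  circle_haar R (cv N @^-1` J) = odo_measure q_ge2 R (residue (Q N) @^-1` J).
Proof.
have E d (T : measurableType d) (m : probability T R) (f : T -> int) :
    discrete_measurable f -> (forall x, 0 <= f x < Q N) ->
    m (f @^-1` J) =
    (\sum_(i <oo | i \in [set i : nat | J i%:Z]) m (f @^-1` [set i%:Z]))%E.
  move=> mf f0; rewrite -measure_bigcup//; last first.
  - by move=> i j _ _ [x [/= -> []]].
  congr (m _); apply/seteqP; split => [x|x [i Ji /= fx]].
    rewrite /preimage /= => Jx; exists `|f x|%N;
      by rewrite /preimage /= gez0_abs//; case/andP: (f0 x).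
  by rewrite /preimage /= fx.
rewrite (E _ _ _ _ (@measurable_circle_value _ _ N)); last exact: circle_value_range.
rewrite (E _ _ _ _ (@measurable_residue _ q_ge2 (Q N))); last first.
  by move=> y; exact: residue_range.
apply: eq_eseriesr => i _; have [iQ|iQ] := boolP (0 <= i%:Z < Q N).
  by rewrite circle_value_law// residue_law.
have -> : residue (Q N) @^-1` [set i%:Z] = set0 :> set Y.
  apply/seteqP; split => // y /= yj; case/negP: iQ; rewrite -yj.
  exact: residue_range.
have -> : cv N @^-1` [set i%:Z] = set0 :> set (circle R).
  apply/seteqP; split => // z /= yj; case/negP: iQ; rewrite -yj.
  exact: circle_value_range.
by rewrite !measure0.
Qed.

(** An intersection-stable generating family on which the uniform laws of the residues determine
    both measures. *)
Let residue_sets : set (set Y) :=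
  [set A | exists N (J : set int), A = residue (Q N) @^-1` J].

Lemma residue_height_mod N M y : (N <= M)%N ->
  (residue (Q M) y %% Q N)%Z = residue (Q N) y.
Proof. by move=> NM; rewrite residue_dvd// dvdz_height. Qed.

Lemma residue_sets_setI : setI_closed residue_sets.
Proof.
have I N M J K : (N <= M)%N ->
    residue_sets (residue (Q N) @^-1` J `&` residue (Q M) @^-1` K).
  move=> NM; exists M, [set v | J (v %% Q N)%Z /\ K v].
  by apply/seteqP; split => y; rewrite /preimage /= residue_height_mod.
move=> _ _ [N [J ->]] [M [K ->]].
have [|/ltnW] := leqP N M; first exact: I.
by rewrite setIC; exact: I.
Qed.

Lemma measurable_residue_setsE : measurable = <<s residue_sets >>.
Proof.
apply/seteqP; split; last first.
  apply: smallest_sub; first exact: sigma_algebra_measurable.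
  by move=> _ [N [J ->]]; exact: measurable_residue.
apply: smallest_sub; first exact: smallest_sigma_algebra.
move=> _ [n [B ->]]; apply: sub_sigma_algebra.
have P0 m : 0 < (P m)%:Z by rewrite ltz_nat radix_prod_gt0.
have digitE y : y n = digit q_ge2 n (`|(residue (Q n.+2) y %% P n.+1)%Z|%N %/ P n).
  apply/val_inj; rewrite /= residue_dvd// residue_radix// absz_nat low_valueS.
  rewrite addnC divnMDl ?radix_prod_gt0// divn_small ?low_value_lt//.
  by rewrite addn0 modn_small.
exists n.+2, [set v | B (digit q_ge2 n (`|(v %% P n.+1)%Z|%N %/ P n))].
by apply/seteqP; split => y; rewrite /preimage /= -digitE.
Qed.

Lemma odometer_of_circle_pushforward A : measurable A ->
  circle_haar R (psi @^-1` A) = odo_measure q_ge2 R A.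
Proof.
move=> mA.
pose m := [the measure _ _ of pushforward (circle_haar R) psi].
rewrite -[LHS]/(m measurable_odometer_of_circle A).
apply: (measure_unique residue_sets (fun=> setT)) => //.
- exact: measurable_residue_setsE.
- exact: residue_sets_setI.
- by move=> _; exists 0, setT.
- by apply/seteqP; split => // x _; exists 0.
- move=> _ [N [J ->]].
  apply: etrans (residue_preimage_law N J); congr (circle_haar R _).
  by apply/seteqP; split => z; rewrite /preimage /= residue_odometer_of_circle.
- by move=> _; rewrite /m /= /pushforward preimage_setT probability_setT ltry.
Qed.

(* A point y of the odometer designates nested arcs.  It is missed by psi only
   if their common point is a right endpoint. *)
Definition limit_arc N y : int :=
  ((p N * time_of_value W N (residue (Q N) y)) %% Q N)%Z.
Local Notation la := limit_arc.

Lemma limit_arc_range N y : 0 <= la N y < Q N.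
Proof. exact: modz_range. Qed.

(** [lower_time] undoes the shift in [time_of_value], so by [arcS] the designated arcs are
    nested. *)
Lemma limit_arcS N y : (la N.+1 y %/ k N)%Z = la N y.
Proof.
rewrite /la (arcS W N _).2; congr ((p N * _ %% Q N)%Z).
rewrite -[RHS](modz_small (time_of_value_range (residue_range y (Q0 N)))).
rewrite /lower_time !divz_cuts (time_of_valueS W N _).1 -!divz_cuts -modzDml.
rewrite (time_of_valueS W N _).2 modzDml subrK.
by rewrite residue_height_mod.
Qed.

Definition left_end N y : R := (la N y)%:~R / (Q N)%:~R.

(** The common point of the closed arcs; [sups] gives access to the measurability of suprema of
    sequences. *)
Definition limit_point y : R := sups (left_end ^~ y) 0.

Let QR N : 0 < (Q N)%:~R :> R. Proof. exact: intr_height_gt0. Qed.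

Lemma left_end_step N y :
  left_end N y <= left_end N.+1 y /\
  left_end N.+1 y + (Q N.+1)%:~R^-1 <= left_end N y + (Q N)%:~R^-1.
Proof.
have k0 : 0 < (k N)%:~R :> R by rewrite ltr0z cuts_gt0.
have E : left_end N y = (la N y * k N)%:~R / (Q N.+1)%:~R.
  rewrite /left_end heightSk (intrM _ (la N y)) (intrM _ (Q N)) invfM.
  rewrite mulrACA divff ?mulr1//.
  exact: lt0r_neq0.
have E' : (Q N)%:~R^-1 = (k N)%:~R / (Q N.+1)%:~R :> R.
  rewrite heightSk (intrM _ (Q N)) invfM mulrCA divff ?mulr1//.
  exact: lt0r_neq0.
have := divz_eq (la N.+1 y) (k N); rewrite limit_arcS.
have := modz_range (la N.+1 y) (cuts_gt0 W N).
set r := (_ %% _)%Z => rk laE.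
split; first by rewrite E /left_end ler_pM2r ?invr_gt0// ler_int; lia.
rewrite E E' /left_end -[X in _ + X <= _]mul1r -!mulrDl ler_pM2r ?invr_gt0//.
by rewrite -[1]/(1%:~R) -!intrD ler_int; lia.
Qed.

Lemma left_end_mono y N M : (N <= M)%N ->
  left_end N y <= left_end M y /\
  left_end M y + (Q M)%:~R^-1 <= left_end N y + (Q N)%:~R^-1.
Proof.
move=> /subnK <-; elim: (M - N)%N => // m [IH1 IH2].
have [s1 s2] := left_end_step (m + N) y; rewrite addSn.
by split; [exact: le_trans s1|exact: le_trans IH2].
Qed.

Lemma left_end_lt N M y : left_end N y < left_end M y + (Q M)%:~R^-1.
Proof.
have [NM|/ltnW MN] := leqP N M.
  have [h _] := left_end_mono y NM; apply: le_lt_trans h _.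
  by rewrite ltrDl invr_gt0.
have [_ h] := left_end_mono y MN; apply: lt_le_trans h.
by rewrite ltrDl invr_gt0.
Qed.

Lemma left_end_ubound y : has_ubound (range (left_end ^~ y)).
Proof.
exists (left_end 0 y + (Q 0)%:~R^-1) => _ [N _ <-].
exact/ltW/left_end_lt.
Qed.

Lemma limit_pointE y : limit_point y = sup (range (left_end ^~ y)).
Proof.
rewrite /limit_point /sups /= /sdrop; congr (sup _).
by apply/seteqP; split => _ [n _ <-]; exists n.
Qed.

Lemma limit_point_itv N y :
  left_end N y <= limit_point y <= left_end N y + (Q N)%:~R^-1.
Proof.
rewrite limit_pointE; apply/andP; split.
  by apply: ub_le_sup; [exact: left_end_ubound|exists N].
apply: ge_sup; first by exists (left_end 0 y); exists 0%N.
by move=> _ [M _ <-]; exact/ltW/left_end_lt.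
Qed.

Definition circle_of_odometer y : circle R := circle_of_real (limit_point y).
Local Notation Phi := circle_of_odometer.

Lemma measurable_circle_of_odometer : measurable_fun setT Phi.
Proof.
apply: (measurableT_comp (@measurable_circle_of_real R)).
apply: measurable_fun_sups => [y _|N]; first exact: left_end_ubound.
apply: discrete_measurable_fun.
exact: (discrete_measurable_comp
  (fun v => ((p N * time_of_value W N v) %% Q N)%Z%:~R / (Q N)%:~R)
  (@measurable_residue _ q_ge2 (Q N))).
Qed.

Lemma left_end_arc N y z : left_end N y <= arg z < left_end N y + (Q N)%:~R^-1 ->
  arc W N z = la N y.
Proof.
move=> h; apply: floor_def.
rewrite -ler_pdivrMr// -ltr_pdivlMr// intrD mulrDl mul1r.
exact: h.
Qed.

Lemma circle_value_of_arc N y z : arc W N z = la N y -> cv N z = residue (Q N) y.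
Proof.
move=> E; have rQ := residue_range y (Q0 N).
rewrite /circle_value /circle_time E /la time_of_arc_mul modz_small.
  by rewrite time_of_valueK.
exact: time_of_value_range.
Qed.

Lemma odometer_of_circleK : cancel psi Phi.
Proof.
move=> z; have E N : la N (psi z) = arc W N z.
  rewrite /la residue_odometer_of_circle value_of_timeK ?circle_time_range//.
  by rewrite -arc_circle_time.
have arg_itv N : left_end N (psi z) <= arg z < left_end N (psi z) + (Q N)%:~R^-1.
  rewrite /left_end E.
  have -> : (arc W N z)%:~R / (Q N)%:~R + (Q N)%:~R^-1 =
      ((arc W N z)%:~R + 1) / (Q N)%:~R :> R by rewrite mulrDl mul1r.
  rewrite ler_pdivrMr// ltr_pdivlMr//.
  by have := floor_itv (arg z * (Q N)%:~R); rewrite intrD.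
rewrite -[RHS]argK; congr circle_of_real.
apply: (@eq_of_close_height R W) => N.
have /andP[a1 a2] := arg_itv N; have /andP[b1 b2] := limit_point_itv N (psi z).
by rewrite ler_norml; apply/andP; split; lra.
Qed.

(** Arcs are closed on the left and open on the right: by hypothesis the limit point lies in every
    designated arc, and arcs determine residues. *)
Lemma circle_of_odometerK y : (forall N, limit_point y < left_end N y + (Q N)%:~R^-1) ->
  psi (Phi y) = y.
Proof.
move=> h; have i01 : 0 <= limit_point y < 1.
  have /andP[a _] := limit_point_itv 0 y; have b := h 0.
  have /andP[c d] := limit_arc_range 0 y.
  apply/andP; split.
    by apply: le_trans a; rewrite divr_ge0 ?ler0z// ltW.
  apply: (lt_le_trans b).
  have -> : left_end 0 y + (Q 0)%:~R^-1 = (la 0 y + 1)%:~R / (Q 0)%:~R.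
    by rewrite intrD mulrDl mul1r.
  by rewrite ler_pdivrMr// mul1r ler_int; lia.
apply: residue_height_inj => N; rewrite residue_odometer_of_circle.
apply: circle_value_of_arc.
apply: left_end_arc; rewrite /Phi circle_of_realK_itv// h andbT.
by have /andP[] := limit_point_itv N y.
Qed.

(** The limit point of a missed [y] is the right end of its arc of some level [N]. The nested arcs
    keep this right end at all deeper levels, so [y] is determined by [N] and that arc. *)
Lemma countable_odometer_of_circle_compl : countable (~` range psi).
Proof.
pose D N := [set y | limit_point y = left_end N y + (Q N)%:~R^-1].
have sub : ~` range psi `<=` \bigcup_N D N.
  move=> y ny; apply: contrapT => nD; apply: ny; exists (Phi y) => //.
  apply: circle_of_odometerK => N; have /andP[_] := limit_point_itv N y.
  by rewrite le_eqVlt => /predU1P[e|//]; case: nD; exists N.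
apply: (sub_countable (subset_card_le sub)); apply: bigcup_countable => // N _.
apply/countable_injP.
pose f y := pickle (la N y).
exists f => y y' /set_mem yD /set_mem yD' /(pcan_inj pickleK) e.
have ll : limit_point y = limit_point y' by rewrite yD yD' /left_end e.
have E (x : Y) M : D N x -> (N <= M)%N ->
    left_end M x = limit_point x - (Q M)%:~R^-1.
  move=> xD NM; have [_ a] := left_end_mono x NM.
  have /andP[_ b] := limit_point_itv M x; rewrite xD in b *; lra.
have la_eq M : (N <= M)%N -> la M y = la M y'.
  move=> NM; have : left_end M y = left_end M y' by rewrite !E// ll.
  have QV : (Q M)%:~R^-1 != 0 :> R by rewrite invr_eq0 lt0r_neq0.
  by rewrite /left_end => /(mulIf QV)/eqP; rewrite eqr_int => /eqP.
apply: residue_height_inj => M; pose L := maxn N M.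
have := la_eq L (leq_maxl _ _); rewrite /la => /(congr1 (time_of_arc W L)).
rewrite !time_of_arc_mul !modz_small ?time_of_value_range ?residue_range//.
move=> /(congr1 (value_of_time W L)).
rewrite !time_of_valueK ?residue_range// => rL.
by rewrite -!(residue_height_mod _ (leq_maxr N M)) -/L rL.
Qed.

Lemma circle_odometer_mpiso : exists Psi : mpiso (circle_haar R) (odo_measure q_ge2 R),
  {ae circle_haar R, forall z, forall N, residue (Q N) (Psi z) = cv N z}.
Proof.
(* Any injective sequence serves [mpiso_patch]; [n.+2] keeps the arguments below 1. *)
pose e n : circle R := circle_of_real (n.+2%:R^-1).
have e_inj : injective e.
  move=> m n /(congr1 (@arg R)).
  have h i : 0 <= (i.+2%:R^-1 : R) < 1.
    apply/andP; split; first by rewrite invr_ge0 ler0n.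
    by rewrite invf_lt1 ?ltr1n ?ltr0n.
  by rewrite !circle_of_realK_itv// => /invr_inj/eqP; rewrite eqr_nat => /eqP[].
have mY (y : Y) : measurable [set y].
  rewrite (_ : [set y] = \bigcap_N (residue (Q N) @^-1` [set residue (Q N) y])).
    by apply: bigcapT_measurable => N; exact: measurable_residue.
  apply/seteqP; split => [_ -> //|y' h]; apply: residue_height_inj => N.
  exact: h.
have [Psi PsiE] := mpiso_patch (@measurable_circle_set1 R) mY (circle_haar_set1 W)
  measurable_odometer_of_circle measurable_circle_of_odometer odometer_of_circleK
  countable_odometer_of_circle_compl e_inj odometer_of_circle_pushforward.
exists Psi; apply: (@negligibleS _ _ _ _ (range e)).
  move=> z /= nz; apply: contrapT => ne; apply: nz => N.
  by rewrite PsiE// residue_odometer_of_circle.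
rewrite (_ : range e = \bigcup_n [set e n]).
  apply: negligible_bigcup => n.
  by apply/(negligibleP _ (@measurable_circle_set1 R _)); exact: (circle_haar_set1 W).
by apply/seteqP; split => [_ [n _ <-]|_ [n _ ->]]; exists n.
Qed.

End CircleOdometer.

(** * The two cocycles *)

Lemma int_of_close (R : realType) (x : R) :
  (forall e, 0 < e -> exists m : int, `|x - m%:~R| <= e) ->
  exists m : int, x = m%:~R.
Proof.
move=> h; exists (Num.floor x); apply/eqP; rewrite -subr_eq0; apply/negPn/negP => f0.
have /andP[f1 f2] := floor_itv x; rewrite intrD in f2.
set f := x - _ in f0; have fpos : 0 < f by rewrite lt_def f0 /f; lra.
(* Half the distance from [x] to the nearest integer. *)
have e0 : 0 < Num.min f (1 - f) / 2.
  by rewrite divr_gt0// lt_min fpos /f; lra.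
have [m] := h _ e0; rewrite ler_norml => /andP[m1 m2].
have [mf|mf] := leP m (Num.floor x).
  have : m%:~R <= (Num.floor x)%:~R :> R by rewrite ler_int.
  have : Num.min f (1 - f) <= f by rewrite ge_min lexx.
  by rewrite /f in fpos *; lra.
have : (Num.floor x)%:~R + 1 <= m%:~R :> R by rewrite -(intrD _ _ 1) ler_int; lia.
have : Num.min f (1 - f) <= 1 - f by rewrite ge_min lexx orbT.
by rewrite /f in fpos *; lra.
Qed.

Section RotationOdometer.
Variables (R : realType) (W : tower).
Variables (q : nat -> nat) (q_ge2 : forall n, (2 <= q n)%N).
Hypothesis q_univ : universal q.
Hypothesis radix_height : forall N, ((radix_prod q N)%:Z %| height W N.+1)%Z.
Variable theta : R.
Hypothesis thetaP : forall N,
  approx R W N < theta <= approx R W N + 2 / (height W N.+1)%:~R.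
Local Notation Q := (height W).
Local Notation k := (cuts W).
Local Notation p := (numer W).
Local Notation Y := (odo_space q_ge2).
Local Notation cv := (circle_value W).
Local Notation ct := (circle_time W).
Local Notation S := (rotation theta).
Local Notation T := (odometer q_ge2 R).
Implicit Types (z : circle R) (y : Y).

Let QR N : 0 < (Q N)%:~R :> R. Proof. exact: intr_height_gt0. Qed.
Let kR N : 0 < (k N)%:~R :> R. Proof. by rewrite ltr0z cuts_gt0. Qed.

Lemma theta_height N :
  (p N)%:~R < theta * (Q N)%:~R /\
  theta * (Q N)%:~R * (k N)%:~R <= (p N)%:~R * (k N)%:~R + 2.
Proof.
have /andP[a b] := thetaP N; split.
  by move: a; rewrite /approx ltr_pdivrMr.
have E : (Q N.+1)%:~R = (Q N)%:~R * (k N)%:~R :> R by rewrite heightSk intrM.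
have := ler_wpM2r (ltW (QR N.+1)) b.
rewrite mulrDl divfK ?gt_eqF// /approx E !mulrA divfK ?gt_eqF//.
Qed.

(** Irrationality of [theta]. As [theta * Q N] exceeds [p N] by a positive amount at most [2 / k N],
    for [j > 0] the integer [m * Q N - j * p N] would be positive and at most [2 * j / k N], which
    is less than 1 at a deep level. *)
Lemma theta_mul_int (j m : int) : j%:~R * theta = m%:~R -> j = 0.
Proof.
wlog j0 : j m / 0 <= j.
  move=> h e; have [j0|j0] := leP 0 j; first exact: h e.
  have : - j = 0; last by lia.
  by apply: (h _ (- m)); [lia|rewrite !mulrNz mulNr e].
move=> e; apply/eqP; rewrite eq_le j0 andbT leNgt; apply/negP => j1.
(* This level is deep enough, since [k N >= Q N > N]. *)
have [N NE] : exists N : nat, N%:Z = 2 * j by exists (2 * `|j|)%N; lia.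
have [a b] := theta_height N.
have j1R : 0 < j%:~R :> R by rewrite ltr0z.
have eQ : j%:~R * (theta * (Q N)%:~R) = (m * Q N)%:~R by rewrite mulrA e intrM.
have a' : j * p N < m * Q N.
  by rewrite -(ltr_int R) intrM -eQ ltr_pM2l.
have b' : m * Q N * k N <= j * p N * k N + 2 * j.
  rewrite -(ler_int R) (intrM _ (m * _)) -eQ.
  have -> : j * p N * k N + 2 * j = j * (p N * k N + 2) by ring.
  by rewrite -mulrA (intrM _ j) ler_pM2l// intrD (intrM _ (p N)).
have kN := height_le_cuts W N; have QN := ltn_height W N.
have : (j * p N + 1) * k N <= m * Q N * k N by rewrite ler_pM2r ?cuts_gt0; lia.
by rewrite mulrDl mul1r; lia.
Qed.

Lemma aut_iter_rotation (s : int) z :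
  aut_iter S s z = rotate (s%:~R * theta) z.
Proof.
elim: s => [|n IH|n IH]; first by rewrite mul0r rotate0.
  rewrite -addn1 PoszD aut_iterS IH /= rotateD; congr (rotate _ z).
  by rewrite intrD; ring.
have nE : - n.+1%:Z + 1 = - n%:Z by lia.
apply: (can_inj (rotateK theta)); rewrite -[LHS]/(S _) -aut_iterS nE IH rotateD.
by congr (rotate _ z); rewrite -nE intrD; ring.
Qed.

Lemma rotation_free z (i j : int) : aut_iter S i z = aut_iter S j z -> i = j.
Proof.
rewrite !aut_iter_rotation -(argK z) !rotate_circle_of_real.
move=> /circle_of_real_eq[m e]; apply/eqP; rewrite -subr_eq0; apply/eqP.
by apply: (@theta_mul_int _ m); rewrite intrB; lra.
Qed.

(** [i - j] would be a multiple of a height larger than its absolute value. *)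
Lemma odometer_free y (i j : int) : aut_iter T i y = aut_iter T j y -> i = j.
Proof.
move=> e; have := congr1 (residue (Q `|i - j|%N)) e.
rewrite !residue_iter ?height_gt0// => /eqP; rewrite eqz_modDl eqz_mod_dvd.
move=> /dvdzP[c]; have := ltn_height W `|i - j|%N.
by have [->|c0] := eqVneq c 0; nia.
Qed.

(** [theta] exceeds the rational angle by at most two arcs of level [N.+1]. Outside the last two of
    the [k N] subarcs of its arc, a point thus lands in the same arc as under the rational
    rotation. *)
Lemma circle_time_rotate N z : (ct N.+1 z %% k N)%Z < k N - 2 ->
  (ct N (rotate theta z) = ct N z + 1 %[mod Q N])%Z.
Proof.
rewrite circle_time_cuts => rk; have [m mE] := arg_rotate theta z.
apply: (@circle_time_shift _ _ _ _ _ _ m); apply: floor_def.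
rewrite mul1r mE; have [a b] := theta_height N.
have /andP[c _] := floor_itv (arg z * (Q N)%:~R); rewrite -/(arc W N z) in c.
have /andP[_ d] := floor_itv (arg z * (Q N.+1)%:~R); rewrite -/(arc W N.+1 z) in d.
rewrite (divz_eq (arc W N.+1 z) (k N)) arcS_div heightSk in d.
move: (_ %% _)%Z rk d => r rk d.
have {}d : arg z * (Q N)%:~R * (k N)%:~R < (arc W N z)%:~R * (k N)%:~R + r%:~R + 1.
  by move: d; rewrite (intrM _ (Q N)) intrD (intrD _ _ r) (intrM _ (arc _ _ _)) mulrA.
have rk' : r%:~R + 3 <= (k N)%:~R :> R.
  by rewrite -(intrD _ r 3) ler_int; lia.
rewrite !intrD !intrM !mulrDl; apply/andP; split; first by lra.
rewrite -(ltr_pM2r (kR N)) !mulrDl; lra.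
Qed.

(** The arcs of [z] and [z'] differ by [s * p N] places, so [arg z' - arg z - s * theta] is within
    [O(1 / Q N)] of an integer at every deep level; hence it is an integer. *)
Lemma rotate_of_times z z' (s : int) n :
  (forall N, (n < N)%N -> ct N z' = ct N z + s) -> z' = aut_iter S s z.
Proof.
move=> tt'.
have close N : (n < N)%N -> exists m : int,
    `|arg z' - arg z - s%:~R * theta - m%:~R| <= (1 + 2 * `|s|%:~R) / (Q N)%:~R.
  move=> nN; pose m := (p N * ct N z %/ Q N)%Z - (p N * ct N z' %/ Q N)%Z.
  have arcE : arc W N z' = arc W N z + s * p N + m * Q N.
    have e := divz_eq (p N * ct N z) (Q N); have e' := divz_eq (p N * ct N z') (Q N).
    rewrite -!arc_circle_time in e e'; rewrite /m.
    have -> : arc W N z' = p N * ct N z' - (p N * ct N z' %/ Q N)%Z * Q N.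
      by rewrite {1}e' addrAC subrr add0r.
    have -> : arc W N z = p N * ct N z - (p N * ct N z %/ Q N)%Z * Q N.
      by rewrite {1}e addrAC subrr add0r.
    rewrite tt'//; ring.
  exists m; rewrite ler_pdivlMr//.
  rewrite -[X in _ * X <= _]gtr0_norm// -normrM.
  have /andP[a1 a2] := floor_itv (arg z * (Q N)%:~R).
  have /andP[b1 b2] := floor_itv (arg z' * (Q N)%:~R).
  rewrite -/(arc W N z) in a1 a2; rewrite -/(arc W N z') arcE in b1 b2.
  rewrite !intrD !intrM in a2 b1 b2.
  have [c1 c2] := theta_height N.
  have k2 : 2 <= (k N)%:~R :> R by rewrite (ler_int R 2) cuts_ge2.
  have d : `|theta * (Q N)%:~R - (p N)%:~R| <= 2.
    by rewrite ler_norml; apply/andP; split; nra.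
  have -> : (arg z' - arg z - s%:~R * theta - m%:~R) * (Q N)%:~R =
      ((arg z' - arg z - m%:~R) * (Q N)%:~R - s%:~R * (p N)%:~R)
      - s%:~R * (theta * (Q N)%:~R - (p N)%:~R) by ring.
  (* The term 1 bounds the positions inside the arcs, the other the error of the rational angle
     repeated [s] times. *)
  apply: le_trans (ler_normB _ _) _; apply: lerD.
    by rewrite ler_norml; apply/andP; split; lra.
  by rewrite normrM intr_norm [leRHS]mulrC ler_wpM2l.
have [m mE] : exists m : int, arg z' - arg z - s%:~R * theta = m%:~R.
  apply: int_of_close => e e0.
  have c0 : 0 < 1 + 2 * `|s|%:~R :> R by rewrite ltr_wpDr// mulr_ge0// ler0z.
  have [|N hN] := @inv_height_small R W (e / (1 + 2 * `|s|%:~R)).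
    by rewrite divr_gt0.
  have [m hm] := close (maxn N n.+1) (leq_maxr _ _).
  exists m; apply: le_trans hm _; rewrite -ler_pdivlMl// mulrC.
  apply: le_trans hN; rewrite lef_pV2 ?posrE// ler_int.
  exact/height_homo/leq_maxl.
rewrite aut_iter_rotation -(argK z') -[in RHS](argK z) rotate_circle_of_real.
by rewrite -(circle_of_realDz (arg z + _) m) -mE; congr circle_of_real; ring.
Qed.

End RotationOdometer.

(** * Measure of the bad sets *)

Lemma le_measureU (R : realType) d (X : measurableType d) (mu : probability X R)
    A B (a b : R) :
  measurable A -> measurable B -> (mu A <= a%:E)%E -> (mu B <= b%:E)%E ->
  (mu (A `|` B) <= (a + b)%:E)%E.
Proof.
move=> mA mB Aa Bb; apply: le_trans (measureU2 mu mA mB) _.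
by rewrite EFinD leeD.
Qed.

Section BadSets.
Variables (R : realType) (W : tower).
Local Notation Q := (height W).
Local Notation k := (cuts W).
Local Notation ct := (circle_time W).

Definition bad_set N : set (circle R) := [set z | bad W N (ct ^~ z)].

Lemma bad_setE N : bad_set N =
  circle_value W N.+1 @^-1` [set Q N.+1 - 1] `|`
  (ct N.+1 @^-1` [set Q N.+1 - 1] `|`
  ([set z | k N.+1 - 2 <= (ct N.+2 z %% k N.+1)%Z < k N.+1] `|`
  ([set z | 0 <= (ct N.+2 z %% Q N.+1)%Z < 2 * Q N] `|`
   [set z | Q N.+1 - 2 * Q N <= (ct N.+2 z %% Q N.+1)%Z < Q N.+1]))).
Proof.
have r1 (z : circle R) := modz_range (ct N.+2 z) (cuts_gt0 W N.+1).
have r2 (z : circle R) := modz_range (ct N.+2 z) (height_gt0 W N.+1).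
apply/seteqP; split => z; rewrite /bad_set /preimage /bad /=.
  move=> /or4P[/eqP|/eqP|h|]; [by left|by right; left| |].
    by right; right; left; have := r1 z; lia.
  by move=> /orP[h|h]; right; right; right; [left|right]; have := r2 z; lia.
move=> [/eqP h|[/eqP h|[h|[h|h]]]]; apply/or4P.
- by constructor 1.
- by constructor 2.
- by constructor 3; lia.
- by constructor 4; lia.
- by constructor 4; lia.
Qed.

Lemma measurable_circle_time_mod N (b m n : int) :
  measurable [set z : circle R | m <= (ct N z %% b)%Z < n].
Proof. exact: (@measurable_circle_time R W N [set t | m <= (t %% b)%Z < n]). Qed.

Lemma measurable_bad_set N : measurable (bad_set N).
Proof.
rewrite bad_setE; apply: measurableU; first exact: measurable_circle_value.
apply: measurableU; first exact: measurable_circle_time.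
by do 2?[apply: measurableU]; exact: measurable_circle_time_mod.
Qed.

(** The five clauses cost [1 / Q N.+1] twice, [2 / k N.+1] once and [2 * Q N / Q N.+1] twice. As
    [k N.+1 >= Q N.+1] and [Q N >= 1], the constants add up to 8. *)
Lemma bad_set_le N :
  (circle_haar R (bad_set N) <= (8 * (Q N)%:~R / (Q N.+1)%:~R)%:E)%E.
Proof.
have QR M : 0 < (Q M)%:~R :> R by exact: intr_height_gt0.
have Q1 : 1 <= (Q N)%:~R :> R by rewrite (ler_int R 1); have := height_gt0 W N; lia.
have qV := ltW (QR N.+1); rewrite -invr_ge0 in qV.
have H : ((Q N.+1)%:~R^-1 + ((Q N.+1)%:~R^-1 + (2 / (k N.+1)%:~R +
     ((2 * (Q N)%:~R) / (Q N.+1)%:~R + (2 * (Q N)%:~R) / (Q N.+1)%:~R)))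
     <= 8 * (Q N)%:~R / (Q N.+1)%:~R :> R).
  have kQ : (k N.+1)%:~R^-1 <= (Q N.+1)%:~R^-1 :> R.
    by rewrite lef_pV2 ?posrE ?ltr0z ?cuts_gt0 ?height_gt0// ler_int height_le_cuts.
  by nra.
apply: le_trans (_ : (_ <= _%:E)%E) _; last by rewrite lee_fin; exact: H.
have mm := measurable_circle_time_mod.
have mU A B : measurable A -> measurable B -> measurable (A `|` B : set (circle R)).
  exact: measurableU.
have mt := @measurable_circle_time R W N.+1 [set Q N.+1 - 1].
have mod_le := @circle_time_mod_law R W N.+2.
have dQ : (Q N.+1 %| Q N.+2)%Z by exact: dvdz_height.
have dk : (k N.+1 %| Q N.+2)%Z by rewrite heightSk dvdz_mull.
have QNN := height_gt0 W N; have Q0 := height_gt0 W N.+1.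
rewrite bad_setE; apply: le_measureU; first exact: measurable_circle_value.
- by do !apply: (mU) => //; exact: mm.
- by rewrite circle_value_law//; lia.
apply: le_measureU => //; first by do !apply: (mU); exact: mm.
  exact: circle_time_law_le.
apply: le_measureU => //; first by do !apply: (mU); exact: mm.
  apply: le_trans (mod_le _ _ _ _ dk _) _; rewrite ?cuts_gt0//; first by lia.
  by rewrite lee_fin opprB addrC subrK.
apply: le_measureU => //.
  apply: le_trans (mod_le _ _ _ _ dQ _) _ => //; first by lia.
  by rewrite lee_fin subr0 intrM.
apply: le_trans (mod_le _ _ _ _ dQ _) _ => //; first by lia.
by rewrite lee_fin opprB addrC subrK intrM.
Qed.

End BadSets.

(** * Orbit equivalence and integrability for a given tower *)

Lemma measurable_aut_iter (R : realType) d (X : measurableType d)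
  (mu : probability X R) (U : aut mu) (j : int) : measurable_fun setT (aut_iter U j).
Proof.
have it (f : X -> X) n : measurable_fun setT f -> measurable_fun setT (iter n f).
  by move=> mf; elim: n => [|n IH]; [exact: measurable_id|exact: measurableT_comp].
case: j => n; first exact/it/measurable_mpfun.
exact/(it _ n.+1)/measurable_mpinv.
Qed.

Lemma measurable_eq_circle (R : realType) d (X : measurableType d)
  (f g : X -> circle R) :
  measurable_fun setT f -> measurable_fun setT g -> measurable [set x | f x = g x].
Proof.
move=> mf mg.
have mb : measurable_fun setT (fun x => arg (f x) == arg (g x)).
  apply: measurable_fun_eqr; exact: (measurableT_comp (@measurable_arg R)).
rewrite (_ : [set x | _] = setT `&` (fun x => arg (f x) == arg (g x)) @^-1` [set true]).
  exact: mb.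
rewrite setTI; apply/seteqP; split => x /=; first by move=> ->; exact: eqxx.
by move=> /eqP/arg_inj.
Qed.

Section TowerEquivalence.
Variables (R : realType) (W : tower).
Variables (q : nat -> nat) (q_ge2 : forall n, (2 <= q n)%N).
Hypothesis q_univ : universal q.
Hypothesis radix_height : forall N, ((radix_prod q N)%:Z %| height W N.+1)%Z.
Variable theta : R.
Hypothesis thetaP : forall N,
  approx R W N < theta <= approx R W N + 2 / (height W N.+1)%:~R.
Local Notation Q := (height W).
Local Notation k := (cuts W).
Local Notation cv := (circle_value W).
Local Notation ct := (circle_time W).
Local Notation S := (rotation theta).
Local Notation T := (odometer q_ge2 R).
Implicit Types (z : circle R).

Let Q0 N : 0 < Q N := height_gt0 W N.

Variable Psi : mpiso (circle_haar R) (odo_measure q_ge2 R).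
Let good z := forall N, residue (Q N) (Psi z) = cv N z.
Hypothesis ae_good : {ae circle_haar R, forall z, good z}.

(** By [values_shift] the deep residues change by a fixed [c], and residues determine a point of the
    odometer. *)
Lemma rotation_cocycle_bound z n : good z -> good (S z) ->
  (forall N, (n <= N)%N -> ~ bad_set W N z) ->
  exists2 c : int, `|c| <= 2 * Q n & S z = mpinv Psi (aut_iter T c (Psi z)).
Proof.
move=> gz gSz nbad.
have nb N : (n <= N)%N -> ~~ bad W N (ct ^~ z) by move=> /nbad/negP.
have [|c cn cE] := values_shift (circle_timeP W z) (circle_timeP W (S z)) nb.
  move=> [//|N] nN; apply: (circle_time_rotate thetaP).
  by have := nb N nN; rewrite /bad; lia.
exists c => //; apply: (can_inj (mpfunK Psi)); rewrite mpinvK.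
apply: (residue_height_inj q_univ radix_height) => N.
rewrite residue_iter// gSz gz.
(* Levels up to [n] are recovered by reduction from a deeper one. *)
have nM : (n < maxn N n.+1)%N by rewrite leq_max leqnn orbT.
have NM := leq_maxl N n.+1.
rewrite -(circle_value_mod W _ NM) -[cv N z](circle_value_mod W _ NM) modzDml.
by congr ((_ %% _)%Z); exact: cE.
Qed.

(** By [times_shift] the deep times change by a fixed [s], and [rotate_of_times] identifies the
    point. *)
Lemma odometer_cocycle_bound z n : good z -> good (mpinv Psi (T (Psi z))) ->
  (forall N, (n <= N)%N -> ~ bad_set W N z) ->
  exists2 s : int, `|s| <= 2 * Q n & mpinv Psi (T (Psi z)) = aut_iter S s z.
Proof.
move=> gz gz' nbad.
have nb N : (n <= N)%N -> ~~ bad W N (ct ^~ z) by move=> /nbad/negP.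
have [|s sn sE] := times_shift (circle_timeP W z)
    (circle_timeP W (mpinv Psi (T (Psi z)))) nb.
  move=> N nN; rewrite -!/(cv _ _) -gz' mpinvK -gz /= residue_succ//.
  by rewrite modz_mod.
by exists s => //; exact: (rotate_of_times thetaP sE).
Qed.

Variables (phi : R -> R) (phi_ge0 : forall t, 0 <= t -> 0 <= phi t).
Variable w : nat -> R.
Hypothesis phi_w : forall n j, j%:Z <= 2 * Q n -> phi j%:R <= w n.
Hypothesis w_ge1 : forall n, 1 <= w n.+1.
Hypothesis w_le : forall n,
  w n.+1 * (8 * (Q n)%:~R / (Q n.+1)%:~R) <= 1 / (2 ^ n.+1)%:R.

Let B n : set (circle R) := bad_set W n.

Let w_bad n : ((w n.+1)%:E * circle_haar R (B n) <= (1 / (2 ^ n.+1)%:R)%:E)%E.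
Proof.
apply: (@le_trans _ _ ((w n.+1)%:E * (8 * (Q n)%:~R / (Q n.+1)%:~R)%:E)%E).
  by rewrite lee_wpmul2l ?bad_set_le// lee_fin (le_trans ler01).
by rewrite -EFinM lee_fin w_le.
Qed.

Let ae_good_S : {ae circle_haar R, forall z, good (S z)}.
Proof. exact: ae_mpiso. Qed.

Let ae_good_T : {ae circle_haar R, forall z, good (mpinv Psi (T (Psi z)))}.
Proof. exact: (ae_mpiso (mpconj Psi T)). Qed.

Let ae_eventually_good : {ae circle_haar R, forall z,
  exists n, forall N, (n <= N)%N -> ~ B N z}.
Proof.
apply: ae_eventually_notin => n; first exact: measurable_bad_set.
apply: le_trans (w_bad n); rewrite -[leLHS]mul1e lee_wpmul2r//.
by rewrite lee_fin.
Qed.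

Let ae_rotation : {ae circle_haar R, forall z,
  exists c, S z = mpinv Psi (aut_iter T c (Psi z))}.
Proof.
apply: filterS3 ae_good ae_good_S ae_eventually_good => z gz gSz [n nB].
by have [c _ cE] := rotation_cocycle_bound gz gSz nB; exists c.
Qed.

Let ae_odometer : {ae circle_haar R, forall z,
  exists s, mpinv Psi (T (Psi z)) = aut_iter S s z}.
Proof.
apply: filterS3 ae_good ae_good_T ae_eventually_good => z gz gTz [n nB].
by have [s _ sE] := odometer_cocycle_bound gz gTz nB; exists s.
Qed.

Lemma tower_integrably_orbit_equivalent :
  integrably_orbit_equivalent phi S T.
Proof.
have aper d (X : measurableType d) (mu : probability X R) (U : aut mu) :
    (forall x i j, aut_iter U i x = aut_iter U j x -> i = j) -> aperiodic U.
  move=> free; apply: aeW => x n n0 e.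
  by have /eqP := free x n%:Z 0 e; rewrite eqz_nat gtn_eqF.
have Sfree := rotation_free thetaP; have Tfree := @odometer_free R W q q_ge2 q_univ.
split; [exact: aper|exact: aper|].
have mS (j : int) : measurable [set z | S z = mpinv Psi (aut_iter T j (Psi z))].
  apply: measurable_eq_circle; first exact: measurable_mpfun.
  apply: measurableT_comp; first exact: measurable_mpinv.
  apply: measurableT_comp; first exact: measurable_aut_iter.
  exact: measurable_mpfun.
have mT (j : int) : measurable
    [set y | T y = mpinv (mpsym Psi) (aut_iter S j (mpsym Psi y))].
  rewrite (_ : [set y | _] =
      [set y | mpinv Psi (T y) = aut_iter S j (mpinv Psi y)]); last first.
    by apply/seteqP; split => y /= => [->|<-]; rewrite ?mpfunK ?mpinvK.
  apply: measurable_eq_circle.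
    apply: measurableT_comp; [exact: measurable_mpinv|exact: measurable_mpfun].
  apply: measurableT_comp; [exact: measurable_aut_iter|exact: measurable_mpinv].
have [cS cSP cSE] := cocycle_exists Tfree ae_rotation mS.
have ae_odometer' : {ae odo_measure q_ge2 R, forall y,
    exists j, T y = mpinv (mpsym Psi) (aut_iter S j (mpsym Psi y))}.
  apply: filterS (ae_mpiso (mpsym Psi) ae_odometer) => y [s] /=.
  by rewrite mpinvK => sE; exists s; rewrite -sE mpinvK.
have [cT cTP cTE] := cocycle_exists Sfree ae_odometer' mT.
have phi_wL n j : (j <= `|(2 * Q n)%R|)%N -> phi j%:R <= w n.
  by move=> jn; apply: phi_w; have := Q0 n; lia.
exists Psi; split; first exact: orbit_equivalenceP.
exists cS, cT; split => //.
  have mc : discrete_measurable cS by case: cSP => /discrete_measurableP.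
  have mB n : measurable (B n) by exact: measurable_bad_set.
  apply: (integral_lty mB phi_ge0 mc phi_wL w_ge1 w_bad).
  apply: filterS2 ae_good ae_good_S => z gz gSz n nB.
  have [c cn /cSE ->] := rotation_cocycle_bound gz gSz nB; lia.
have mc : discrete_measurable cT by case: cTP => /discrete_measurableP.
(* The bad sets are transported to the odometer by [Psi], with the same measures. *)
have mB n : measurable (mpinv Psi @^-1` B n).
  rewrite -[X in measurable X]setTI; apply: measurable_mpinv => //.
  exact: measurable_bad_set.
apply: (integral_lty mB phi_ge0 mc phi_wL w_ge1).
  move=> n; have := mpsym_pushforward Psi (@measurable_bad_set R W n).
  by rewrite /pushforward => ->; exact: w_bad.
have := ae_mpiso (mpsym Psi) ae_good_T; have := ae_mpiso (mpsym Psi) ae_good.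
apply: filterS2 => y gz gTz n nB.
have [s sn /= sE] := odometer_cocycle_bound gz gTz nB.
have -> : cT y = s; last by lia.
by apply: cTE; rewrite /= -sE !mpinvK.
Qed.

End TowerEquivalence.

(** * Choice of the angle *)

Section Sublinear.
Variables (R : realType) (phi : R -> R).
Hypothesis phi_ge0 : forall t : R, 0 <= t -> 0 <= phi t.

Definition sublinear := forall e : R, 0 < e ->
  exists J : nat, forall j, (J <= j)%N -> phi j%:R <= e * j%:R.

Lemma sublinear_of_littleo_powR (a : R) : a <= 1 ->
  phi =o_ (pinfty_nbhs R) (fun t => t `^ a) -> sublinear.
Proof.
move=> a1 /eqoP h e e0; have [M [_ hM]] := h e e0.
(* From this index on, [j > M] and [j >= 1], so the power with exponent [a] is at most [j]. *)
exists (Num.truncn `|M|).+2 => j Jj.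
have jM : M < j%:R.
  apply: le_lt_trans (ler_norm M) _; apply: lt_trans (truncnS_gt `|M|) _.
  by rewrite ltr_nat.
have j1 : 1 <= j%:R :> R by rewrite ler1n; lia.
have := hM _ jM; rewrite /= !ger0_norm ?powR_ge0 ?phi_ge0// => /le_trans; apply.
by rewrite ler_pM2l// ler1_powR.
Qed.

Lemma bounded_prefix (n : nat) : exists C : R, forall j, (j <= n)%N -> phi j%:R <= C.
Proof.
exists (\sum_(i < n.+1) phi i%:R) => j jn.
rewrite (bigD1 (Ordinal (jn : (j < n.+1)%N)))//= lerDl.
by apply: sumr_ge0 => i _; exact: phi_ge0.
Qed.

Hypothesis phi_sub : sublinear.

(** Up to a fixed threshold [phi] is bounded, and [e * y] exceeds the bound for large [y]. Beyond
    it, sublinearity with constant [e / 2] suffices, as [j <= 2 * y]. *)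
Lemma sublinear_bound (e : R) : 0 < e -> exists J : int, forall y : int, J <= y ->
  1 <= e * y%:~R /\ forall j : nat, j%:Z <= 2 * y -> phi j%:R <= e * y%:~R.
Proof.
move=> e0; have [J0 hJ0] := phi_sub (divr_gt0 e0 (ltr0Sn R 1)).
have [C hC] := bounded_prefix J0.
have He x (y : int) : Num.floor (x / e) + 1 <= y -> x <= e * y%:~R.
  move=> xy; rewrite mulrC -ler_pdivrMr//; apply: le_trans (ltW (floorD1_gt _)) _.
  by rewrite ler_int.
exists (Num.max (Num.max (Num.floor (C / e) + 1) (Num.floor (1 / e) + 1)) 0) => y.
rewrite !ge_max => /andP[/andP[yC y1] y0]; split; first exact: He.
move=> j jy; have [jJ|/ltnW/hC jJ] := leqP J0 j; last first.
  exact: le_trans jJ (He _ _ yC).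
apply: le_trans (hJ0 _ jJ) _.
have jR : j%:R <= 2 * y%:~R :> R by rewrite -[2]/((2 : int)%:~R) -intrM (ler_int R j).
by rewrite -mulrA ler_pM2l// mulrC ler_pdivrMr// mulrC.
Qed.

Variables (q : nat -> nat) (q_ge2 : forall n, (2 <= q n)%N).

(** Here [x] is the current height and [y] the next one. This [e] makes the weight [e * y] times the
    bound [8 * x / y] on the bad set equal to [1 / 2 ^ N.+1]. Positivity of [x] is placed inside so
    that a choice function exists on all integers. *)
Lemma next_ratio (N : nat) (K x : int) : exists l : int, 2 <= l /\ (0 < x ->
  let y := x * (x * l) in let e : R := (2 ^+ N.+1 * (8 * x%:~R))^-1 in
  [/\ ((radix_prod q N)%:Z %| y)%Z, K <= y, 1 <= e * y%:~R &
      forall j : nat, j%:Z <= 2 * y -> phi j%:R <= e * y%:~R]).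
Proof.
have [x0|x0] := ltP 0 x; last by exists 2; split => // x0'; lia.
have [|J hJ] := @sublinear_bound (2 ^+ N.+1 * (8 * x%:~R))^-1.
  by rewrite invr_gt0 mulr_gt0 ?exprn_gt0// mulr_gt0// ltr0z.
have P0 : 0 < (radix_prod q N)%:Z by rewrite ltz_nat radix_prod_gt0.
(* The first factor gives the divisibility, the second puts [y] above [K] and [J]. *)
exists ((radix_prod q N)%:Z * (2 + `|K| + `|J|)); split; first by nia.
move=> _ y e.
have ym : 2 + `|K| + `|J| <= y.
  have -> : y = (x * (x * (radix_prod q N)%:Z)) * (2 + `|K| + `|J|) by rewrite /y; ring.
  have xP : 0 < x * (x * (radix_prod q N)%:Z) by rewrite !mulr_gt0.
  by rewrite ler_peMl; lia.
have Jy : J <= y by lia.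
have [e1 e2] := hJ y Jy.
split => //; last by lia.
by rewrite /y mulrA dvdz_mull// dvdz_mulr.
Qed.

Lemma tower_exists (a b K : int) : 0 < b -> coprimez a b ->
  exists (W : tower) (w : nat -> R),
    [/\ height W 0 = b, numer W 0 = a, K <= height W 1,
        forall N, ((radix_prod q N)%:Z %| height W N.+1)%Z &
     [/\ forall n j, j%:Z <= 2 * height W n -> phi j%:R <= w n,
         forall n, 1 <= w n.+1 &
         forall n, w n.+1 * (8 * (height W n)%:~R / (height W n.+1)%:~R)
           <= 1 / (2 ^ n.+1)%:R]].
Proof.
move=> b0 ab.
have /choice[L HL] : forall Nx : nat * int, exists l : int, 2 <= l /\ (0 < Nx.2 ->
  let y := Nx.2 * (Nx.2 * l) in let e : R := (2 ^+ Nx.1.+1 * (8 * Nx.2%:~R))^-1 in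
  [/\ ((radix_prod q Nx.1)%:Z %| y)%Z, K <= y, 1 <= e * y%:~R &
      forall j : nat, j%:Z <= 2 * y -> phi j%:R <= e * y%:~R]).
  by move=> [N x]; exact: next_ratio.
pose H := fix H N := if N is M.+1 then H M * (H M * L (M, H M)) else b.
pose r N := L (N, H N).
pose A := fix A N := if N is M.+1 then A M * (H M * r M) + 1 else a.
have [[u v] /= uv] := coprimezP _ _ ab.
(* With [k = H M * r M], the product of [1 - A M * k] and [1 + A M * k] is [1 - A M ^ 2 * k ^ 2],
   and [k ^ 2 = r M * H M.+1]. *)
pose U N := if N is M.+1 then 1 - A M * (H M * r M) else u.
have UA N : (U N * A N = 1 %[mod H N])%Z.
  case: N => [|N]; apply/eqP; rewrite eqz_mod_dvd; apply/dvdzP => /=.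
    by exists (- v); rewrite -uv; ring.
  by exists (- (A N * A N * r N)); rewrite /r; ring.
pose W := @Tower H r A U b0 (fun N => (HL (N, H N)).1) (fun=> erefl) (fun=> erefl) UA.
have [C hC] := bounded_prefix `|(2 * b)%R|%N.
(* This weight turns the last estimate into an equality; at level 0, [C] bounds [phi] up to
   [2 * b]. *)
pose w N := if N is M.+1 then (2 ^+ M.+1 * (8 * (H M)%:~R))^-1 * (H M.+1)%:~R else C.
have hW N := (HL (N, H N)).2 (height_gt0 W N).
exists W, w; split => //; [by have [] := hW 0|by move=> N; have [] := hW N|split].
- case=> [|n] j jn; last by have [_ _ _] := hW n; exact.
  by apply: hC; move: jn => /=; lia.
- by move=> n; have [] := hW n.
move=> n; have Hn : 0 < (H n)%:~R :> R by rewrite ltr0z; exact: (height_gt0 W n).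
have Hn1 : 0 < (H n.+1)%:~R :> R by rewrite ltr0z; exact: (height_gt0 W n.+1).
rewrite /w -[height W n]/(H n) -[height W n.+1]/(H n.+1) natrX.
move: (H n.+1)%:~R (H n)%:~R Hn Hn1 => h h' h0 h0'; rewrite le_eqVlt; apply/orP; left.
have p2 : (2 : R) ^+ n.+1 != 0 by rewrite expf_neq0.
by apply/eqP; field; rewrite p2 !gt_eqF.
Qed.

End Sublinear.

(** * The limit angle and density *)

Section LimitAngle.
Variables (R : realType) (W : tower).
Local Notation Q := (height W).
Local Notation k := (cuts W).
Local Notation approx := (approx R W).

(** The angle grows by [1 / Q N.+1], and [2 / Q N.+2] is at most this increment. *)
Lemma approx_step N :
  approx N < approx N.+1 /\
  approx N.+1 + 2 / (Q N.+2)%:~R <= approx N + 2 / (Q N.+1)%:~R.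
Proof.
have QR M : 0 < (Q M)%:~R :> R by exact: intr_height_gt0.
have k0 : 0 < (k N)%:~R :> R by rewrite ltr0z cuts_gt0.
have E : approx N.+1 = approx N + (Q N.+1)%:~R^-1.
  rewrite /approx numerS -/(k N) heightSk intrD (intrM _ (numer W N)) (intrM _ (Q N)).
  by field; rewrite !gt_eqF.
have Q2 : 2 / (Q N.+2)%:~R <= (Q N.+1)%:~R^-1 :> R.
  rewrite ler_pdivrMr// [_^-1 * _]mulrC ler_pdivlMr//.
  rewrite (heightSk W N.+1) (intrM _ (Q N.+1)) mulrC.
  by rewrite ler_pM2l// (ler_int R 2) cuts_ge2.
have QV : 0 < (Q N.+1)%:~R^-1 :> R by rewrite invr_gt0.
rewrite E; split; first by rewrite ltrDl.
lra.
Qed.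

(** The supremum of the rational angles; their strict growth gives the strict inequality. *)
Lemma limit_angle_exists : exists theta : R, forall N,
  approx N < theta <= approx N + 2 / (Q N.+1)%:~R.
Proof.
have mono N M : (N <= M)%N -> approx N <= approx M /\
    approx M + 2 / (Q M.+1)%:~R <= approx N + 2 / (Q N.+1)%:~R.
  move=> /subnK <-; elim: (M - N)%N => // m [IH1 IH2].
  have [s1 s2] := approx_step (m + N); rewrite addSn.
  by split; [exact: le_trans IH1 (ltW s1)|exact: le_trans IH2].
have ub N M : approx M <= approx N + 2 / (Q N.+1)%:~R.
  have Q0 L : 0 <= 2 / (Q L)%:~R :> R.
    by rewrite divr_ge0// ltW// intr_height_gt0.
  have [NM|/ltnW MN] := leqP N M.
    by have [_] := mono _ _ NM; apply: le_trans; rewrite lerDl.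
  by have [h _] := mono _ _ MN; apply: le_trans h _; rewrite lerDl.
exists (sup (range approx)) => N; apply/andP; split.
  have [s _] := approx_step N; apply: lt_le_trans s _.
  apply: ub_le_sup; last by exists N.+1.
  by exists (approx 0 + 2 / (Q 1)%:~R) => _ [M _ <-]; exact: ub.
by apply: ge_sup; [exists (approx 0); exists 0%N|move=> _ [M _ <-]; exact: ub].
Qed.

End LimitAngle.

Lemma dense_integrably_equivalent_angles (R : realType) (phi : R -> R)
    (phi_ge0 : forall t : R, 0 <= t -> 0 <= phi t) (phi_sub : sublinear phi)
    (q : nat -> nat) (q_ge2 : forall n, (2 <= q n)%N)
    (q_univ : universal q) :
  dense [set theta : R | irrational theta /\
    integrably_orbit_equivalent phi (rotation theta) (odometer q_ge2 R)].
Proof.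
move=> O [x Ox] oO; have /nbhs_ballP[e /= e0 eO] : nbhs x O.
  exact: open_nbhs_nbhs.
(* The tower starts from the angle [r]. Then [theta] exceeds [r] by at most 2 over the height of
   level 1, and requiring that height to exceed [4 / e] makes this less than [e / 2]. *)
have /rat_in_itvoo[r] : x < x + e / 2 by rewrite ltrDl divr_gt0.
rewrite in_itv /= => /andP[xr re].
have d0 := denq_gt0 r.
have cop : coprimez (numq r) (denq r).
  by rewrite coprimezE; exact: coprime_num_den.
have [W [w [H0 A0 K1 PW [w1 w2 w3]]]] :=
  tower_exists phi_ge0 phi_sub q_ge2 (Num.floor (4 / e) + 1) d0 cop.
have [theta thetaP] := limit_angle_exists R W.
have Q1 : 0 < (height W 1)%:~R :> R by exact: intr_height_gt0.
have /andP[t1 t2] := thetaP 0%N.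
have a0 : approx R W 0 = ratr r by rewrite /approx H0 A0 /ratr.
have Q2 : 2 / (height W 1)%:~R < e / 2 :> R.
  have h : 4 / e < (height W 1)%:~R.
    by apply: lt_le_trans (floorD1_gt _) _; rewrite ler_int.
  by rewrite ltr_pdivrMr// in h; rewrite ltr_pdivrMr//; lra.
exists theta; split.
  rewrite a0 in t1 t2; apply: eO; rewrite /ball /= ltr_norml.
  by apply/andP; split; lra.
split.
  (* The denominator of a rational [theta] would be a nonzero integer multiplying it to an
     integer. *)
  move=> [s _ sE]; have := @theta_mul_int R W theta thetaP (denq s) (numq s).
  rewrite -sE /ratr mulrCA divff ?mulr1.
    by move=> /(_ erefl)/eqP; rewrite denq_eq0.
  by rewrite intr_eq0 denq_eq0.
have [Psi Psi_good] := circle_odometer_mpiso R q_ge2 q_univ PW.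
exact: (tower_integrably_orbit_equivalent q_univ PW thetaP Psi_good phi_ge0 w1 w2 w3).
Qed.

Theorem theorem3 (R : realType) (phi : R -> R)
    (phi_ge0 : forall t : R, 0 <= t -> 0 <= phi t)
    (phi_o : phi =o_ (pinfty_nbhs R) (fun t => t `^ 3^-1))
    (q : nat -> nat) (q_ge2 : forall n, (2 <= q n)%N)
    (q_universal : universal q) :
  dense [set theta : R | irrational theta /\
    integrably_orbit_equivalent phi (rotation theta) (odometer q_ge2 R)].
Proof.
apply: dense_integrably_equivalent_angles => //.
by apply: sublinear_of_littleo_powR phi_o => //; rewrite invf_le1 ?ler1n.
Qed.
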